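(* For every $m\in\mathbb{N}$ and $\delta>0$ there exists $\varepsilon=\varepsilon(m,\delta)>0$ such that for every finite $m$-torsion abelian group $Z$ and any 1-bounded function $f:Z\to\mathbb{C}$ with $\|f\|_{U^3}>\delta$, there exists a polynomial $P:Z\to\mathbb{R}/\mathbb{Z}$ of degree at most $2$ such that $|\mathbb{E}_{x\in Z}f(x)e(-P(x))|>\varepsilon$.
   Context: An abelian group $Z$ is $m$-torsion if $mx=0$ for all $x\in Z$. A function is 1-bounded if its modulus is at most 1; $\mathbb{E}$ denotes the average; $e(t)=e^{2\pi i t}$. $\|f\|_{U^3}^{8}=\mathbb{E}_{x,h_1,h_2,h_3\in Z}\prod_{v\in\{0,1\}^3}\mathcal{C}^{|v|}f(x+v_1h_1+v_2h_2+v_3h_3)$, with $\mathcal{C}$ complex conjugation and $|v|=v_1+v_2+v_3$. A map $P:Z\to Z'$ between abelian groups is polynomial of degree at most $k$ if $\partial_{h_1}\cdots\partial_{h_{k+1}}P(x)=0$ for all $x,h_1,\dots,h_{k+1}\in Z$, where $\partial_hP(x)=P(x+h)-P(x)$. *)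

(* Defs.v *)
From HB Require Import structures.
From mathcomp Require Import all_boot all_order all_algebra.
From mathcomp Require Import generic_quotient ring_quotient complex.
From mathcomp Require Import reals trigo.

Set Implicit Arguments.
Unset Strict Implicit.
Unset Printing Implicit Defensive.

Import Order.TTheory GRing.Theory Num.Theory.
Local Open Scope ring_scope.
Local Open Scope quotient_scope.
Local Open Scope complex_scope.

(* R/Z as the library's quotient of zmodTypes; [Num.int_num_subdef] is the
   predicate underlying [Num.int]. *)
Definition integers (R : realType) : zmodClosed R :=
  GRing.ZmodClosed.clone R (@Num.int_num_subdef R) _.

Notation circle R := (@Quotient.quot R (integers R)).

Definition expi2pi (R : realType) (t : R) : R[i] :=
  cos (2 * pi * t) +i* sin (2 * pi * t).

(* e (t) = exp (2 i pi t) on R/Z; see [e_pi] for independence of the choice of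
   representative. *)
Definition e (R : realType) (t : circle R) : R[i] := expi2pi (repr t).

Section ExpCircle.
Variable R : realType.
Implicit Types s t : R.

Lemma expi2piD s t : expi2pi (s + t) = expi2pi s * expi2pi t.
Proof.
rewrite /expi2pi mulrDr cosD sinD; apply/eqP; rewrite eq_complex /=.
by rewrite addrC [X in _ && (X == _)]addrC !eqxx; apply/andP; split => //; rewrite addrC.
Qed.

Lemma expi2pi_nat n : expi2pi (n%:R : R) = 1.
Proof.
elim: n => [|n IHn]; first by rewrite /expi2pi mulr0 cos0 sin0.
rewrite -addn1 natrD expi2piD IHn mul1r /expi2pi mulr1 mulr_natl.
by rewrite cos2pi sin2pi.
Qed.

Lemma expi2pi_int t : t \is a Num.int -> expi2pi t = 1.
Proof.
move=> /intrP[[n|n] ->]; first exact: expi2pi_nat.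
rewrite NegzE mulrNz; set m := (_ : int)%:~R.
have <- : expi2pi (- m + m) = 1 by rewrite addNr (expi2pi_nat 0).
by rewrite expi2piD expi2pi_nat mulr1.
Qed.

Lemma e_pi t : e (\pi_(circle R) t) = expi2pi t.
Proof.
rewrite /e; case: piP => s /eqP.
rewrite eqmodE /= Quotient.equivE => /expi2pi_int ets.
by rewrite -[t](subrK s) expi2piD ets mul1r.
Qed.

End ExpCircle.

Definition torsion (m : nat) (Z : zmodType) := forall x : Z, x *+ m = 0.

Section Polynomial.
Variables Z Z' : zmodType.

Definition fdiff (h : Z) (P : Z -> Z') (x : Z) : Z' := P (x + h) - P x.

Definition poly_deg_le (k : nat) (P : Z -> Z') :=
  forall (h : k.+1.-tuple Z) (x : Z), foldr fdiff P h x = 0.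

End Polynomial.

Definition avg (R : realType) (T : finType) (F : T -> R[i]) : R[i] :=
  #|T|%:R^-1 * \sum_x F x.

Notation "\E_ x F" := (avg (fun x => F))
  (at level 36, x name, F at level 36, format "\E_ x  F") : ring_scope.

Section U3.
Variables (R : realType) (Z : finZmodType).
Implicit Type f : Z -> R[i].

Definition one_bounded f := forall x, `|f x| <= 1.

Definition U3_avg f : R[i] :=
  \E_x \E_h1 \E_h2 \E_h3
    \prod_(v : bool * bool * bool) let: (v1, v2, v3) := v in
      iter (v1 + v2 + v3)%N Num.conj
        (f (x + h1 *+ v1 + h2 *+ v2 + h3 *+ v3)).

(* [U3_avg f] is a nonnegative real, and [8.-root] is then its nonnegative
   real eighth root, seen in R[i]. *)
Definition U3_norm f : R[i] := 8.-root (U3_avg f).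

End U3.

(* Main.v *)
(* Let G = Z x Z^, where Z^ is identified with Z by a nondegenerate symmetric
   pairing p, and let F(h, xi) = |E_x f(x+h) f(x)^* e(-p(xi, x))|^2.  This
   function takes values in [0, 1], satisfies sum F <= |Z| and
   sum F^2 = |Z| ||f||_{U^3}^8, and is positive definite on G; hence for every
   set A on which F is large, F is also large on many differences of elements
   of A.
   - This hereditary property makes one dependent random choice sufficient, in
     the style of Balog-Szemeredi-Gowers, to find a set whose popular
     differences H satisfy |4H| = O(|Z|).  As G is m-torsion, a Ruzsa covering
     argument puts H in a subgroup K with |K| = O(|Z|), and F has mass >> |Z|
     on K.
   - The symmetry argument (repeated Cauchy-Schwarz) shows that the
     radical of the commutator form p(xi, x') - p(xi', x) on K has bounded
     index, so we may assume that K is isotropic.  Then K defines a symmetric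
     bilinear form on its projection H to Z, which has bounded index.
   - Let Z be the direct sum of the cyclic groups <b_i>.  Grouping the b_i by
     their order and their class modulo H gives an endomorphism rho of Z with
     bounded image and x - rho(x) in H.  Pulling the form back by 1 - rho
     gives a symmetric form B on Z itself, and
     B(x, y) = Q(x+y) - Q(x) - Q(y) for a quadratic Q : Z -> R/Z.
   - On the fibres of rho, f e(-Q) has a large U^2 norm, so it correlates with a
     character. *)

From HB Require Import structures.
Require Import Defs.
From mathcomp Require Import all_boot all_order all_algebra.
From mathcomp Require Import all_fingroup all_solvable.
From mathcomp Require Import generic_quotient ring_quotient.
From mathcomp Require Import complex reals trigo.
From mathcomp Require Import ring lra.

Set Implicit Arguments.
Unset Strict Implicit.
Unset Printing Implicit Defensive.

Import Order.TTheory GRing.Theory Num.Theory FinRing.Theory.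
Local Open Scope ring_scope.
Local Open Scope complex_scope.

HB.saturate prod.

Arguments e {R} t : simpl never.
Arguments expi2pi {R} t : simpl never.
Arguments conjc {R} x : simpl never.

(** * Complex numbers, additive maps and characters *)

Section SquaredModulus.
Variable R : realType.
Implicit Types z w : R[i].

(** The squared modulus as an element of [R]: estimates then take place in a totally ordered field,
    whereas the order of [R[i]] is partial. *)
Definition sqm z : R := complex.Re z ^+ 2 + complex.Im z ^+ 2.

Lemma sqm_ge0 z : 0 <= sqm z.
Proof. by rewrite addr_ge0 ?sqr_ge0. Qed.

Lemma sqm_norm z : (sqm z)%:C = `|z| ^+ 2.
Proof. exact: add_Re2_Im2. Qed.

Lemma sqm_conj z : (sqm z)%:C = z * z^*%C.
Proof. by rewrite sqm_norm sqr_normc. Qed.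

Lemma sqmM z w : sqm (z * w) = sqm z * sqm w.
Proof. by apply: complexI; rewrite rmorphM /= !sqm_norm normrM exprMn. Qed.

Lemma sqmJ z : sqm z^*%C = sqm z.
Proof. by case: z => a b; rewrite /sqm /conjc /= sqrrN. Qed.

Lemma sqm_real (r : R) : sqm r%:C = r ^+ 2.
Proof. by rewrite /sqm /= expr0n addr0. Qed.

Lemma sqm_nat n : sqm n%:R = n%:R ^+ 2.
Proof. by rewrite -sqm_real rmorph_nat. Qed.

Lemma sqm1 : sqm 1 = 1.
Proof. by rewrite -[1]/(1%:C) sqm_real expr1n. Qed.

Lemma sqm_le1 z : (sqm z <= 1) = (`|z| <= 1).
Proof.
by rewrite -lecR sqm_norm expr_le1.
Qed.

Lemma real_complex_sum (I : Type) (r : seq I) (P : pred I) (F : I -> R) :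
  (\sum_(i <- r | P i) F i)%:C = \sum_(i <- r | P i) (F i)%:C.
Proof. exact: raddf_sum. Qed.

Lemma conjc_sum (I : Type) (r : seq I) (P : pred I) (F : I -> R[i]) :
  (\sum_(i <- r | P i) F i)^*%C = \sum_(i <- r | P i) (F i)^*%C.
Proof. exact: raddf_sum. Qed.

Lemma sqm_sum (I : finType) (P : pred I) (u : I -> R[i]) :
  (sqm (\sum_(i | P i) u i))%:C =
  \sum_(i | P i) \sum_(j | P j) u i * (u j)^*%C.
Proof.
rewrite sqm_conj conjc_sum mulr_suml; apply: eq_bigr => i _.
by rewrite mulr_sumr.
Qed.

(* Lagrange's identity, as [0 <= sum_ij |u_i (v_j)^* - u_j (v_i)^*|^2]. *)
Lemma cauchy_schwarz (I : finType) (P : pred I) (u v : I -> R[i]) :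
  sqm (\sum_(i | P i) u i * v i) <=
  (\sum_(i | P i) sqm (u i)) * (\sum_(i | P i) sqm (v i)).
Proof.
rewrite -lecR rmorphM /= !real_complex_sum sqm_sum.
set A := (X in X <= _); set B := (X in _ <= X).
have: 0 <= \sum_(i | P i) \sum_(j | P j)
    (sqm (u i * (v j)^*%C - u j * (v i)^*%C))%:C.
  by apply: sumr_ge0 => i _; apply: sumr_ge0 => j _; rewrite ler0c sqm_ge0.
suff ->: \sum_(i | P i) \sum_(j | P j)
    (sqm (u i * (v j)^*%C - u j * (v i)^*%C))%:C = (B - A) *+ 2.
  by rewrite pmulrn_lge0 // subr_ge0.
have EB : B = \sum_(i | P i) \sum_(j | P j) (sqm (u i))%:C * (sqm (v j))%:C.
  by rewrite /B mulr_suml; apply: eq_bigr => i _; rewrite mulr_sumr.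
have EB' : B = \sum_(i | P i) \sum_(j | P j) (sqm (u j))%:C * (sqm (v i))%:C.
  by rewrite EB exchange_big.
have EA : A = \sum_(i | P i) \sum_(j | P j) u j * v j * (u i * v i)^*%C.
  by rewrite /A exchange_big.
rewrite mulr2n {1}EB' {1}EA EB /A -!sumrB -big_split /=; apply: eq_bigr => i _.
rewrite -!sumrB -big_split /=; apply: eq_bigr => j _.
rewrite !sqm_conj rmorphB !rmorphM /= !conjcK; ring.
Qed.

(** The form of Cauchy-Schwarz that discards bounded weights [u]. *)
Lemma sqm_sum_le (I : finType) (P : pred I) (u v : I -> R[i]) :
  (forall i, P i -> sqm (u i) <= 1) ->
  sqm (\sum_(i | P i) u i * v i) <= #|P|%:R * \sum_(i | P i) sqm (v i).
Proof.
move=> u1; apply: le_trans (cauchy_schwarz _ _ _) _.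
apply: ler_wpM2r; first by apply: sumr_ge0 => i _; exact: sqm_ge0.
by apply: le_trans (ler_sum _ u1) _; rewrite sumr_const.
Qed.

Lemma sqm_sum_le_card (I : finType) (P : pred I) (v : I -> R[i]) :
  sqm (\sum_(i | P i) v i) <= #|P|%:R * \sum_(i | P i) sqm (v i).
Proof.
have /= := @sqm_sum_le _ P (fun=> 1) v.
under eq_bigr do rewrite mul1r.
by apply=> i _; rewrite sqm1.
Qed.

Lemma sqr_sum_le (I : finType) (P : pred I) (v : I -> R) :
  (\sum_(i | P i) v i) ^+ 2 <= #|P|%:R * \sum_(i | P i) v i ^+ 2.
Proof.
rewrite -sqm_real real_complex_sum.
apply: le_trans (sqm_sum_le_card _ _) _.
by under eq_bigr do rewrite sqm_real.
Qed.

End SquaredModulus.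

Section AdditiveMaps.
Variables (U V : zmodType) (f : U -> V).
Hypothesis fD : {morph f : x y / x + y}.

Lemma morphD0 : f 0 = 0.
Proof. by apply: (addrI (f 0)); rewrite -fD !addr0. Qed.

Lemma morphDN : {morph f : x / - x}.
Proof. by move=> x; apply: (addrI (f x)); rewrite -fD !subrr morphD0. Qed.

Lemma morphDB : {morph f : x y / x - y}.
Proof. by move=> x y; rewrite fD morphDN. Qed.

Lemma morphDMn n : {morph f : x / x *+ n}.
Proof.
by move=> x; elim: n => [|n IHn]; rewrite ?mulr0n ?morphD0 // !mulrS fD IHn.
Qed.

Lemma morphD_sum (I : Type) (r : seq I) (P : pred I) (F : I -> U) :
  f (\sum_(i <- r | P i) F i) = \sum_(i <- r | P i) f (F i).
Proof. exact: (big_morph f fD morphD0). Qed.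

End AdditiveMaps.

Section CircleExponential.
Variable R : realType.
Implicit Types s t : circle R.

Definition toC (r : R) : circle R := \pi_(circle R)%qT r.

Lemma toCD : {morph toC : x y / x + y}.
Proof. exact: raddfD. Qed.

Lemma circle_lift s : exists r : R, s = toC r.
Proof. by exists (repr s); rewrite /toC reprK. Qed.

Lemma toC_eq (r r' : R) : (toC r == toC r') = (r - r' \is a Num.int).
Proof. by rewrite eqmodE /= Quotient.equivE. Qed.

Lemma toC_eq0 (r : R) : (toC r == 0) = (r \is a Num.int).
Proof. by rewrite -(morphD0 toCD) toC_eq subr0. Qed.

Lemma eD s t : e (s + t) = e s * e t.
Proof.
case: (circle_lift s) => x ->; case: (circle_lift t) => y ->.
by rewrite -toCD !e_pi expi2piD.
Qed.

Lemma e0 : e (0 : circle R) = 1.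
Proof. by rewrite -(morphD0 toCD) e_pi (expi2pi_nat R 0). Qed.

Lemma eN s : e (- s) = (e s)^*%C.
Proof.
case: (circle_lift s) => x ->; rewrite -(morphDN toCD) !e_pi.
by rewrite /expi2pi mulrN cosN sinN.
Qed.

Lemma eB s t : e (s - t) = e s * (e t)^*%C.
Proof. by rewrite eD eN. Qed.

Lemma sqm_e s : sqm (e s) = 1.
Proof.
by case: (circle_lift s) => x ->; rewrite e_pi /sqm /= cos2Dsin2.
Qed.

(** Take a representative [y] in [0, 1): there [1 - cos (2 * pi * y)] equals
    [2 * sin (pi * y) ^+ 2], which is positive unless [y = 0]. *)
Lemma e_eq1 s : e s = 1 -> s = 0.
Proof.
case: (circle_lift s) => x ->; set y := x - (Num.floor x)%:~R.
have -> : toC x = toC y.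
  by apply/eqP; rewrite toC_eq opprB addrC subrK intr_int.
have y0 : 0 <= y by rewrite subr_ge0 ge_floor.
have y1 : y < 1 by rewrite ltrBlDl -[1]/(1%:~R) -intrD lt_succ_floor.
rewrite e_pi /expi2pi => -[cos1 _].
have sin0 : sin (pi * y) = 0.
  have E : cos (2 * pi * y) = 1 - 2 * sin (pi * y) ^+ 2.
    have -> : 2 * pi * y = pi * y + pi * y by rewrite -mulrA mulr_natl mulr2n.
    by rewrite cosD -!expr2 cos2sin2; ring.
  by apply/eqP; rewrite -sqrf_eq0; apply/eqP; lra.
have [->|yN0] := eqVneq y 0; first exact: morphD0 toCD.
have : 0 < sin (pi * y).
  have := pi_gt0 R => pi0; apply: sin_gt0_pi; apply/andP; split.
    by rewrite mulr_gt0 // lt_neqAle eq_sym yN0.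
  by rewrite -{2}[pi]mulr1 ltr_pM2l.
by rewrite sin0 ltxx.
Qed.

End CircleExponential.

Section FiniteSubgroups.
Variables (G : finZmodType).

Definition subgroup (K : {set G}) :=
  0 \in K /\ (forall x y, x \in K -> y \in K -> x - y \in K).

Variable K : {set G}.
Hypothesis sK : subgroup K.

Lemma subgroup0 : 0 \in K. Proof. by case: sK. Qed.

Lemma subgroupB x y : x \in K -> y \in K -> x - y \in K.
Proof. by case: sK => _; apply. Qed.

Lemma subgroupN x : x \in K -> - x \in K.
Proof. by move=> xK; rewrite -sub0r subgroupB // subgroup0. Qed.

Lemma subgroupD x y : x \in K -> y \in K -> x + y \in K.
Proof. by move=> xK yK; rewrite -[y]opprK subgroupB // subgroupN. Qed.

Lemma subgroup_addr x y : y \in K -> (x + y \in K) = (x \in K).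
Proof.
move=> yK; apply/idP/idP => [|xK]; last exact: subgroupD.
by move=> xyK; rewrite -(addrK y x) subgroupB.
Qed.

Lemma subgroup_opp x : (- x \in K) = (x \in K).
Proof. by apply/idP/idP => /subgroupN; rewrite ?opprK. Qed.

Lemma subgroup_subr x y : y \in K -> (x - y \in K) = (x \in K).
Proof. by move=> yK; rewrite subgroup_addr // subgroupN. Qed.

Lemma subgroup_card_gt0 : (0 < #|K|)%N.
Proof. by apply/card_gt0P; exists 0; exact: subgroup0. Qed.

Lemma sum_subgroup_shift (V : nmodType) (F : G -> V) a : a \in K ->
  \sum_(k in K) F (k + a) = \sum_(k in K) F k.
Proof.
move=> aK; rewrite [RHS](reindex_inj (addIr a)) /=.
by apply: eq_bigl => k; rewrite subgroup_addr.
Qed.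

(** If [phi a] is nonzero for some [a] in [K], translation by [a] preserves the sum but multiplies
    it by [e (phi a) != 1]. *)
Lemma character_sum (R : realType) (phi : G -> circle R) :
  {in K &, {morph phi : x y / x + y}} ->
  \sum_(k in K) e (phi k) = #|K|%:R *+ [forall k in K, phi k == 0].
Proof.
move=> phiD; case: forallP => /= [phi0|/forallP].
  rewrite (eq_bigr (fun=> 1)) ?sumr_const // => k kK.
  by move: (phi0 k); rewrite kK => /eqP ->; rewrite e0.
rewrite negb_forall => /existsP[a]; rewrite negb_imply => /andP[aK phia].
set S := \sum_(k in K) _.
have E : e (phi a) * S = S.
  rewrite /S -[RHS](sum_subgroup_shift (fun k => e (phi k)) aK).
  rewrite mulr_sumr; apply: eq_bigr => k kK.
  by rewrite phiD // eD mulrC.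
apply/eqP; have /eqP : (e (phi a) - 1) * S = 0 by rewrite mulrBl mul1r E subrr.
rewrite mulf_eq0 subr_eq0 => /orP[/eqP/e_eq1 phi0|//].
by rewrite phi0 eqxx in phia.
Qed.

End FiniteSubgroups.

(** * The radical of a bilinear form *)

Section Radical.
Variables (R : realType) (G : finZmodType) (K : {set G}).
Hypothesis sK : subgroup K.
Variable beta : G -> G -> circle R.
Hypothesis betaDl : forall z, {morph beta^~ z : x y / x + y}.
Hypothesis betaDr : forall x, {morph beta x : y z / y + z}.

(** The radical on [K] of the alternating form [beta y z - beta z y], called [omega] below, rather
    than that of [beta]. *)
Definition radical : {set G} :=
  [set k in K | [forall y in K, beta y k == beta k y]].

Let omega y z := beta y z - beta z y.

Let omegaBr y z t : omega y (z - t) = omega y z - omega y t.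
Proof.
by rewrite /omega (morphDB (betaDr y)) (morphDB (betaDl y)) !opprD !opprK addrACA.
Qed.

Lemma subgroup_radical : subgroup radical.
Proof.
split=> [|x y]; rewrite !inE.
  rewrite subgroup0 //=; apply/forall_inP => y _.
  by rewrite (morphD0 (betaDr y)) (morphD0 (betaDl y)).
move=> /andP[xK /forall_inP hx] /andP[yK /forall_inP hy].
rewrite subgroupB //=; apply/forall_inP => z zK.
rewrite (morphDB (betaDr z)) (morphDB (betaDl z)).
by rewrite (eqP (hx z zK)) (eqP (hy z zK)).
Qed.

Lemma card_radical_coset z : z \in K ->
  #|[pred t in K | z - t \in radical]| = #|radical|.
Proof.
move=> zK; rewrite -(card_imset (mem radical) (subrI z)); apply: eq_card => t.
rewrite [LHS]inE; apply/andP/imsetP => [[tK ztR]|[x]].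
  by exists (z - t); rewrite ?subKr.
move=> xR ->; rewrite subKr; split=> //; rewrite subgroupB //.
by move: xR; rewrite inE => /andP[].
Qed.

(** After expanding the square, the sum over [y] is a character sum: it is [#|K|] if [z - t] lies in
    the radical and 0 otherwise, which leaves [#|K| * #|radical|] pairs. *)
Lemma sum_sqm_omega (g : G -> R[i]) : (forall x, sqm (g x) <= 1) ->
  \sum_(y in K) sqm (\sum_(z in K) g z * e (omega y z)) <=
  #|K|%:R ^+ 2 * #|radical|%:R.
Proof.
move=> g1; set X := \sum_(y in K) _.
have X0 : 0 <= X by apply: sumr_ge0 => y _; exact: sqm_ge0.
pose u z t : R[i] := g z * (g t)^*%C * #|K|%:R.
have EX : X%:C = \sum_(z in K) \sum_(t in K | z - t \in radical) u z t.
  rewrite real_complex_sum.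
  under eq_bigr do rewrite sqm_sum.
  rewrite exchange_big; apply: eq_bigr => z zK; rewrite exchange_big /=.
  rewrite big_mkcondr; apply: eq_bigr => t tK.
  under eq_bigr do rewrite rmorphM /= mulrACA -eB -omegaBr.
  rewrite -mulr_sumr character_sum //; last first.
    by move=> a b _ _ /=; rewrite /omega betaDl betaDr opprD addrACA.
  rewrite inE subgroupB //=.
  under [in RHS]eq_forallb do rewrite -subr_eq0.
  by case: ifP => _; rewrite ?mulr1n // mulr0n mulr0.
(* Since [X] is real and nonnegative, bounding its complex expansion amounts to bounding [X ^+ 2],
   by Cauchy-Schwarz in [z] and then in [t]. *)
rewrite -ler_sqr ?nnegrE //; last by rewrite mulr_ge0 ?exprn_ge0.
rewrite -sqm_real EX; apply: le_trans (sqm_sum_le_card _ _) _.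
have -> : (#|K|%:R ^+ 2 * #|radical|%:R) ^+ 2 =
    #|K|%:R * \sum_(i in K) (#|radical|%:R ^+ 2 * #|K|%:R ^+ 2) :> R.
  rewrite sumr_const -[_ *+ #|_|]mulr_natl; ring.
apply: ler_wpM2l => //; apply: ler_sum => z zK.
apply: le_trans (sqm_sum_le_card _ _) _.
rewrite card_radical_coset // expr2 -mulrA ler_wpM2l //.
rewrite mulr_natl -[in leRHS](card_radical_coset zK) -sumr_const.
apply: ler_sum => t _; rewrite /u !sqmM sqmJ sqm_nat ler_piMl ?exprn_ge0 //.
by rewrite mulr_ile1 ?sqm_ge0.
Qed.

(* After Cauchy-Schwarz in [z = k + l], the substitution [z = s + l + l'] leaves
   for each [s] the kernel [e (omega l l')] times a function of [l] and a function
   of [l']. *)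
Lemma card_radical_ge (b g1 g2 : G -> R[i]) :
  (forall x, sqm (b x) <= 1) -> (forall x, sqm (g1 x) <= 1) ->
  (forall x, sqm (g2 x) <= 1) ->
  sqm (\sum_(k in K) \sum_(l in K)
         b k * g1 (k + l) * g2 l * e (- beta k l)) ^+ 2 <=
  #|K|%:R ^+ 7 * #|radical|%:R.
Proof.
move=> b1 g11 g21; set S := \sum_(k in K) _.
pose w z l : R[i] := b (z - l) * g2 l * e (- beta (z - l) l).
have ES : S = \sum_(z in K) g1 z * \sum_(l in K) w z l.
  rewrite /S; under [RHS]eq_bigr do rewrite mulr_sumr.
  rewrite exchange_big [RHS]exchange_big; apply: eq_bigr => l lK.
  rewrite -[RHS](sum_subgroup_shift sK _ lK); apply: eq_bigr => z zK /=.
  by rewrite /w addrK; ring.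
set X := \sum_(z in K) sqm (\sum_(l in K) w z l).
have X0 : 0 <= X by apply: sumr_ge0 => y _; exact: sqm_ge0.
have SX : sqm S <= #|K|%:R * X by rewrite ES; exact: sqm_sum_le.
pose al s l : R[i] := g2 l * (b (s + l))^*%C * e (- beta s l).
pose ga s l : R[i] := b (s + l) * (g2 l)^*%C * e (beta s l).
have al1 s l : sqm (al s l) <= 1.
  by rewrite !sqmM sqmJ sqm_e mulr1 mulr_ile1 ?sqm_ge0.
have ga1 s l : sqm (ga s l) <= 1.
  by rewrite !sqmM sqmJ sqm_e mulr1 mulr_ile1 ?sqm_ge0.
have EX : X%:C = \sum_(s in K) \sum_(l in K) al s l *
    \sum_(l' in K) ga s l' * e (omega l l').
  rewrite real_complex_sum; under eq_bigr do rewrite sqm_sum.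
  rewrite exchange_big [RHS]exchange_big; apply: eq_bigr => l lK.
  under [RHS]eq_bigr do rewrite mulr_sumr.
  rewrite exchange_big [RHS]exchange_big; apply: eq_bigr => l' lK'.
  have llK : l + l' \in K by exact: subgroupD.
  rewrite -[LHS](sum_subgroup_shift sK _ llK); apply: eq_bigr => s _ /=.
  rewrite /w rmorphM rmorphM /=. rewrite -eN.
  have -> : s + (l + l') - l = s + l' by rewrite addrA addrAC addrK.
  have -> : s + (l + l') - l' = s + l by rewrite addrA addrK.
  (* The phase [beta (s + l) l' - beta (s + l') l] equals [beta s l' - beta s l + omega l l']. *)
  rewrite opprK !betaDl /al /ga /omega !(eD, eN); ring.
have X2 : X ^+ 2 <= #|K|%:R ^+ 5 * #|radical|%:R.
  rewrite -sqm_real EX; apply: le_trans (sqm_sum_le_card _ _) _.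
  have -> : #|K|%:R ^+ 5 * #|radical|%:R =
    #|K|%:R * \sum_(i in K) (#|K|%:R * (#|K|%:R ^+ 2 * #|radical|%:R)) :> R.
    rewrite sumr_const -[_ *+ #|_|]mulr_natl; ring.
  apply: ler_wpM2l => //; apply: ler_sum => s sK'.
  apply: le_trans (sqm_sum_le _ _) _ => [l _|]; first exact: al1.
  by apply: ler_wpM2l => //; apply: sum_sqm_omega; exact: ga1.
apply: le_trans (_ : (#|K|%:R * X) ^+ 2 <= _).
  by rewrite ler_sqr ?nnegrE ?sqm_ge0 // mulr_ge0.
rewrite exprMn; apply: le_trans (ler_wpM2l (exprn_ge0 2 (ler0n _ _)) X2) _.
by rewrite le_eqVlt; apply/orP; left; apply/eqP; ring.
Qed.

End Radical.

(** * Subgroups from positive definite functions *)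

Lemma card_set_in (J : finType) (B : {set J}) (P : pred J) :
  #|[set j in B | P j]| = (\sum_(j in B) P j)%N.
Proof.
rewrite -sum1dep_card big_mkcondr /=.
by apply: eq_bigr => j _; case: (P j).
Qed.

Lemma sum_card_exchange (I J : finType) (A : {set I}) (B : {set J})
    (P : I -> J -> bool) :
  (\sum_(i in A) #|[set j in B | P i j]| =
   \sum_(j in B) #|[set i in A | P i j]|)%N.
Proof.
under eq_bigr do rewrite card_set_in.
by rewrite exchange_big; under [RHS]eq_bigr do rewrite card_set_in.
Qed.

Lemma sum_card_dep (I J : finType) (A : {set I}) (T : I -> {set J}) :
  (\sum_(i in A) #|T i| = #|[set q | (q.1 \in A) && (q.2 \in T q.1)]|)%N.
Proof.
under eq_bigr do rewrite -sum1_card.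
by rewrite pair_big_dep /= sum1dep_card.
Qed.

(** The averaging principle behind each later choice of a good point, coset or frequency. *)
Lemma exists_sum_le (R : realDomainType) (I : finType) (A : {set I})
    (u v : I -> R) :
  A != set0 -> \sum_(i in A) u i <= \sum_(i in A) v i ->
  exists2 i, i \in A & u i <= v i.
Proof.
move=> /set0Pn[i0 i0A] uv; apply/exists_inP; apply: contraLR uv => /exists_inPn H.
rewrite -ltNge (bigD1 i0) //= [ltRHS](bigD1 i0) //= ltr_leD //.
  by rewrite ltNge H.
by apply: ler_sum => i /andP[iA _]; rewrite ltW // ltNge H.
Qed.

(** * Sumsets and the covering argument *)

Section Sumsets.
Variable G : finZmodType.
Implicit Types A B D H K S T V W : {set G}.

Definition sumset A B : {set G} := [set a + b | a in A, b in B].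

Lemma sumsetP A B x :
  reflect (exists a b, [/\ a \in A, b \in B & x = a + b]) (x \in sumset A B).
Proof.
apply: (iffP imset2P) => [[a b aA bB ->]|[a [b [aA bB ->]]]].
  by exists a, b.
by exists a b.
Qed.

Lemma mem_sumset A B a b : a \in A -> b \in B -> a + b \in sumset A B.
Proof. by move=> aA bB; apply/sumsetP; exists a, b. Qed.

Lemma card_sumset_le A B : (#|sumset A B| <= #|A| * #|B|)%N.
Proof. by rewrite /sumset curry_imset2X -cardsX leq_imset_card. Qed.

(** [V] consists of the sums of multiples [t *+ k], one for each entry [t] of [s], with [k < m]. *)
Lemma torsion_span (m : nat) (s : seq G) : (0 < m)%N -> torsion m G ->
  exists V, [/\ 0 \in V, forall t v, t \in s -> v \in V -> v + t \in V &
                (#|V| <= m ^ size s)%N].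
Proof.
move=> m0 tG; elim: s => [|t s [V [V0 VD cV]]].
  by exists [set 0]; split; rewrite ?set11 // cards1.
pose M := [set t *+ (k : 'I_m) | k in 'I_m].
have Mk k : t *+ k \in M.
  apply/imsetP; exists (Ordinal (ltn_pmod k m0)) => //=.
  by rewrite {1}(divn_eq k m) mulrnDr mulrnA tG add0r.
exists (sumset V M); split.
- by rewrite -[0]addr0 mem_sumset // -(mulr0n t).
- move=> u _ us /sumsetP[v [_ [vV /imsetP[k _ ->] ->]]].
  move: us; rewrite inE => /orP[/eqP ->|us].
    by rewrite -addrA -mulrSr mem_sumset.
  by rewrite addrAC mem_sumset // VD.
- rewrite expnS mulnC; apply: leq_trans (card_sumset_le _ _) _.
  by apply: leq_mul => //; rewrite -[X in (_ <= X)%N]card_ord leq_imset_card.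
Qed.

(** Closure under addition suffices because [- y] is [y *+ m.-1]. *)
Lemma torsion_subgroup (m : nat) K : (0 < m)%N -> torsion m G -> 0 \in K ->
  (forall x y, x \in K -> y \in K -> x + y \in K) -> subgroup K.
Proof.
move=> m0 tG K0 KD; split=> // x y xK yK; apply: (KD) => //.
have -> : - y = y *+ m.-1.
  by apply: (addrI y); rewrite subrr -mulrS prednK // tG.
elim: m.-1 => [|n IH]; first by rewrite mulr0n.
by rewrite mulrS KD.
Qed.

(* A maximal family [T] in [3H] of points with disjoint translates [t + H] has
   at most [|4H| / |H|] elements, and [3H] is contained in [T + 2H]; so
   [span T + 2H] absorbs [H]. *)
Lemma covering_subgroup (m n : nat) H : (0 < m)%N -> torsion m G ->
  0 \in H -> (forall x, x \in H -> - x \in H) ->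
  (#|sumset (sumset (sumset H H) H) H| <= n * #|H|)%N ->
  exists K, [/\ subgroup K, H \subset K &
    (#|K| <= m ^ n * #|sumset (sumset (sumset H H) H) H|)%N].
Proof.
move=> m0 tG H0 HN; set H2 := sumset H H; set H3 := sumset H2 H.
set H4 := sumset H3 H => cH4.
pose ok T := (T \subset H3) && [forall t in T, forall t' in T,
  forall h in H, forall h' in H, (t + h == t' + h') ==> (t == t')].
have okP T : reflect (T \subset H3 /\ forall t t' h h', t \in T -> t' \in T ->
    h \in H -> h' \in H -> t + h = t' + h' -> t = t') (ok T).
  apply: (iffP andP) => -[TH hT]; split=> //.
    move=> t t' h h' tT tT' hH hH' E.
    move/forall_inP/(_ t tT)/forall_inP/(_ t' tT')/forall_inP/(_ h hH): hT.
    by move/forall_inP/(_ h' hH'); rewrite E eqxx => /eqP.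
  do 4![apply/forall_inP => ? ?]; apply/implyP => /eqP E; apply/eqP.
  by apply: hT E.
have ok0 : ok set0 by apply/okP; split=> [|t]; rewrite ?sub0set ?inE.
have [T /maxsetP[/okP[TH Tdis] Tmax] _] := maxset_exists ok0.
have cT : (#|T| <= n)%N.
  have cH : (0 < #|H|)%N by apply/card_gt0P; exists 0.
  rewrite -(leq_pmul2r cH); apply: leq_trans cH4.
  have -> : (#|T| * #|H| = #|sumset T H|)%N.
    rewrite /sumset curry_imset2X card_in_imset ?cardsX //.
    move=> [t h] [t' h'] /setXP[/= tT hH] /setXP[/= tT' hH'] E.
    have Et := Tdis _ _ _ _ tT tT' hH hH' E.
    by move: E; rewrite Et => /addrI ->.
  apply: subset_leq_card; apply/subsetP => _ /sumsetP[t [h [tT hH ->]]].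
  by rewrite mem_sumset // (subsetP TH).
have H3T x : x \in H3 -> exists t h h', [/\ t \in T, h \in H, h' \in H &
    x = t + (h + h')].
  move=> xH3; have [xT|xT] := boolP (x \in T).
    by exists x, 0, 0; rewrite !addr0.
  have : ~~ ok (x |: T).
    by apply: contra xT => /Tmax <-; rewrite ?subsetUr // setU11.
  rewrite /ok subUset sub1set xH3 TH /= => /forall_inPn[t tT].
  case/forall_inPn => t' tT' /forall_inPn[h hH] /forall_inPn[h' hH'].
  rewrite negb_imply => /andP[/eqP E tt'].
  move: tT tT'; rewrite !inE => /orP[/eqP tx|tT] /orP[/eqP tx'|tT'].
  - by rewrite tx tx' eqxx in tt'.
  - exists t', h', (- h); split; rewrite ?HN // -tx addrA -E.
    by rewrite addrK.
  - exists t, h, (- h'); split; rewrite ?HN // -tx' addrA E.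
    by rewrite addrK.
  - by rewrite (Tdis t t' h h') ?eqxx in tt'.
have [V [V0 VD cV]] := torsion_span (enum T) m0 tG.
rewrite -cardE in cV.
have H20 : 0 \in H2 by rewrite -[0]addr0 mem_sumset.
pose W := sumset V H2.
have WH w h : w \in W -> h \in H -> w + h \in W.
  move=> /sumsetP[v [x [vV xH2 ->]]] hH; rewrite -addrA.
  have /H3T[t [h1 [h2 [tT hH1 hH2 ->]]]] : x + h \in H3 by exact: mem_sumset.
  rewrite addrA mem_sumset ?VD ?mem_enum //; exact: mem_sumset.
(* [K] is the stabiliser of [W]: it contains [H] because [W + H] is in [W], and it lies in [W]
   because 0 does. *)
pose K := [set x | [forall w in W, w + x \in W]].
have W0 : 0 \in W by rewrite -[0]addr0 mem_sumset.
exists K; split.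
- apply: torsion_subgroup m0 tG _ _; rewrite ?inE.
    by apply/forall_inP => w; rewrite addr0.
  move=> x y; rewrite !inE => /forall_inP hx /forall_inP hy.
  by apply/forall_inP => w wW; rewrite addrA hy // hx.
- apply/subsetP => h hH; rewrite inE; apply/forall_inP => w wW; exact: WH.
- have KW : K \subset W.
    by apply/subsetP => x; rewrite inE => /forall_inP/(_ 0 W0); rewrite add0r.
  apply: leq_trans (subset_leq_card KW) _.
  apply: leq_trans (card_sumset_le _ _) _; apply: leq_mul.
    by apply: leq_trans cV _; rewrite leq_pexp2l.
  apply: subset_leq_card; apply/subsetP => x xH2.
  by rewrite -[x]addr0 mem_sumset // -[x]addr0 mem_sumset.
Qed.

End Sumsets.

(** * Popular differences and dependent random choice *)

Section PopularDifferences.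
Variables (R : realType) (G : finZmodType).
Implicit Types A B D H K S T V W : {set G}.

(** Its cardinal is the number of ways to write [x] as [b - a] with [a] and [b] in [A]. *)
Definition pop A x : {set G} := [set a in A | a + x \in A].

Lemma sum_pop A B :
  (\sum_(x in B) #|pop A x| = \sum_(a in A) #|[set b in A | (b - a)%R \in B]|)%N.
Proof.
rewrite /pop sum_card_exchange; apply: eq_bigr => a aA.
rewrite -(card_imset _ (addIr a)); apply: eq_card => b; rewrite !inE.
apply/imsetP/andP => [[x]|[bA bB]].
  by rewrite inE => /andP[xB axA] ->; rewrite addrK addrC.
by exists (b - a); rewrite ?subrK // inE bB [a + _]addrC subrK.
Qed.

Lemma sum_pop_all A : (\sum_x #|pop A x| = #|A| ^ 2)%N.
Proof.
transitivity (\sum_(x in [set: G]) #|pop A x|)%N.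
  by apply: eq_bigl => x; rewrite inE.
rewrite sum_pop.
under eq_bigr => a _.
  have -> : [set b in A | b - a \in setT] = A by apply/setP => b; rewrite !inE andbT.
  over.
by rewrite sum_nat_const.
Qed.

Lemma popN A x : #|pop A (- x)| = #|pop A x|.
Proof.
rewrite -[RHS](card_imset _ (addIr x)); apply: eq_card => b; rewrite !inE.
apply/andP/imsetP => [[bA bxA]|[a]].
  by exists (b - x); rewrite ?subrK // inE bxA subrK.
by rewrite inE => /andP[aA axA] ->; rewrite addrK.
Qed.

Definition bad_pairs D A : {set G * G} :=
  [set q | [&& q.1 \in A, q.2 \in A & q.1 - q.2 \notin D]].

(* Count the quadruples [x_1,..,x_4] in [A] such that [y_i = x_i + h_i] is in
   [A] and the links [y_i - x_(i+1)] are in [D]: there are many for each [s],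
   and [s] and the [x_i] can be recovered from [x_1], [y_4] and the links. *)
Lemma card_fourfold_sumset (c : R) A D H : 0 < c -> A != set0 ->
  (forall x, x \in H -> c * #|A|%:R <= #|pop A x|%:R) ->
  #|bad_pairs D A|%:R <= c ^+ 4 / 6 * #|A|%:R ^+ 2 ->
  #|sumset (sumset (sumset H H) H) H|%:R * (c ^+ 4 / 2 * #|A|%:R ^+ 2) <=
  #|D|%:R ^+ 3.
Proof.
move=> c0 A0 Hpop badle; set Q := sumset _ _.
(* [h s] will be a fixed decomposition of [s] into four elements of [H], with zeros as default
   outside [Q]. *)
pose dec s (q : G * G * G * G) := s \in Q ->
  [/\ q.1.1.1 \in H, q.1.1.2 \in H, q.1.2 \in H, q.2 \in H
    & s = q.1.1.1 + q.1.1.2 + q.1.2 + q.2].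
have [h hP] : exists h, forall s, dec s (h s).
  apply: (fin_all_exists (P := dec)) => s; rewrite /dec.
  have [sQ|sQ] := boolP (s \in Q); last first.
    by exists (0, 0, 0, 0).
  move: (sQ) => /sumsetP[? [h4 [/sumsetP[? [h3 [/sumsetP[h1 [h2 [h1H h2H ->]]]]]]]]].
  by move=> h3H -> h4H ->; exists (h1, h2, h3, h4).
pose P1 s := pop A (h s).1.1.1; pose P2 s := pop A (h s).1.1.2.
pose P3 s := pop A (h s).1.2; pose P4 s := pop A (h s).2.
pose all s := setX (setX (setX (P1 s) (P2 s)) (P3 s)) (P4 s).
pose l1 s (x : G * G * G * G) := x.1.1.1 + (h s).1.1.1 - x.1.1.2.
pose l2 s (x : G * G * G * G) := x.1.1.2 + (h s).1.1.2 - x.1.2.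
pose l3 s (x : G * G * G * G) := x.1.2 + (h s).1.2 - x.2.
pose good s := [set x in all s | [&& l1 s x \in D, l2 s x \in D & l3 s x \in D]].
pose B1 s := [set x in all s | l1 s x \notin D].
pose B2 s := [set x in all s | l2 s x \notin D].
pose B3 s := [set x in all s | l3 s x \notin D].
have memall s x : x \in all s -> [/\ (x.1.1.1 \in A), (x.1.1.2 \in A),
    (x.1.2 \in A) & (x.2 \in A)] /\ [/\ (x.1.1.1 + (h s).1.1.1 \in A),
    (x.1.1.2 + (h s).1.1.2 \in A), (x.1.2 + (h s).1.2 \in A) &
    (x.2 + (h s).2 \in A)].
  rewrite !inE => /andP[/andP[/andP[/andP[-> ->] /andP[-> ->]] /andP[-> ->]]].
  by move=> /andP[-> ->].
(* A failing link is a bad pair, and the two other coordinates range over [A]. The three links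
   together spoil at most [c ^+ 4 / 2 * #|A| ^+ 4] quadruples, half of the lower bound for
   [#|all s|]. *)
have badX : #|setX (setX (bad_pairs D A) A) A|%:R <= c ^+ 4 / 6 * #|A|%:R ^+ 4 :> R.
  rewrite !cardsX !natrM.
  apply: le_trans (_ : c ^+ 4 / 6 * #|A|%:R ^+ 2 * #|A|%:R * #|A|%:R <= _).
    by do 2!apply: ler_wpM2r => //.
  by rewrite le_eqVlt; apply/orP; left; apply/eqP; ring.
have cB1 s : #|B1 s|%:R <= c ^+ 4 / 6 * #|A|%:R ^+ 4 :> R.
  apply: le_trans badX; rewrite ler_nat.
  pose f (x : G * G * G * G) := (x.1.1.1 + (h s).1.1.1, x.1.1.2, x.1.2, x.2).
  have fI : injective f by move=> [[[? ?] ?] ?] [[[? ?] ?] ?] [/addIr -> -> -> ->].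
  rewrite -(card_imset _ fI); apply: subset_leq_card; apply/subsetP => y /imsetP[x].
  rewrite inE => /andP[/memall[[? ? ? ?] [? ? ? ?]] ?] ->; rewrite !inE /=.
  by apply/andP; split => //; apply/andP; split => //; apply/and3P.
have cB2 s : #|B2 s|%:R <= c ^+ 4 / 6 * #|A|%:R ^+ 4 :> R.
  apply: le_trans badX; rewrite ler_nat.
  pose f (x : G * G * G * G) := (x.1.1.2 + (h s).1.1.2, x.1.2, x.1.1.1, x.2).
  have fI : injective f by move=> [[[? ?] ?] ?] [[[? ?] ?] ?] [/addIr -> -> -> ->].
  rewrite -(card_imset _ fI); apply: subset_leq_card; apply/subsetP => y /imsetP[x].
  rewrite inE => /andP[/memall[[? ? ? ?] [? ? ? ?]] ?] ->; rewrite !inE /=.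
  by apply/andP; split => //; apply/andP; split => //; apply/and3P.
have cB3 s : #|B3 s|%:R <= c ^+ 4 / 6 * #|A|%:R ^+ 4 :> R.
  apply: le_trans badX; rewrite ler_nat.
  pose f (x : G * G * G * G) := (x.1.2 + (h s).1.2, x.2, x.1.1.1, x.1.1.2).
  have fI : injective f by move=> [[[? ?] ?] ?] [[[? ?] ?] ?] [/addIr -> -> -> ->].
  rewrite -(card_imset _ fI); apply: subset_leq_card; apply/subsetP => y /imsetP[x].
  rewrite inE => /andP[/memall[[? ? ? ?] [? ? ? ?]] ?] ->; rewrite !inE /=.
  by apply/andP; split => //; apply/andP; split => //; apply/and3P.
have cgood s : s \in Q -> c ^+ 4 / 2 * #|A|%:R ^+ 4 <= #|good s|%:R :> R.
  move=> /hP[h1 h2 h3 h4 _].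
  have : (#|all s| <= #|good s| + #|B1 s| + #|B2 s| + #|B3 s|)%N.
    apply: leq_trans (_ : #|good s :|: B1 s :|: B2 s :|: B3 s| <= _)%N.
      apply: subset_leq_card; apply/subsetP => x xs.
      have E P : (x \in [set y in all s | P y]) = P x by rewrite inE xs.
      by rewrite !in_setU !E; do 3![case: (_ \in D)].
    do 2![apply: leq_trans (leq_card_setU _ _) _; rewrite leq_add2r].
    exact: leq_card_setU.
  rewrite -(ler_nat R) !natrD => le1.
  have : c ^+ 4 * #|A|%:R ^+ 4 <= #|all s|%:R :> R.
    rewrite !cardsX !natrM -exprMn; set x := c * _.
    have x0 : 0 <= x by rewrite mulr_ge0 // ltW.
    have Hx y : y \in H -> x <= #|pop A y|%:R by exact: Hpop.
    move: x x0 Hx => x x0 Hx; rewrite !exprS expr0 mulr1 !mulrA.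
    have x2 := mulr_ge0 x0 x0; have x3 := mulr_ge0 x2 x0.
    apply: (ler_pM x3 x0); last exact: (Hx _ h4).
    apply: (ler_pM x2 x0); last exact: (Hx _ h3).
    by apply: (ler_pM x0 x0); [exact: (Hx _ h1)|exact: (Hx _ h2)].
  by move: (cB1 s) (cB2 s) (cB3 s); lra.
pose T := [set q : G * (G * G * G * G) | (q.1 \in Q) && (q.2 \in good q.1)].
have cT : #|Q|%:R * (c ^+ 4 / 2 * #|A|%:R ^+ 4) <= #|T|%:R :> R.
  rewrite -sum_card_dep natr_sum mulr_natl -sumr_const.
  by apply: ler_sum => s; exact: cgood.
have cT' : (#|T| <= #|A| * #|D| * #|D| * #|D| * #|A|)%N.
  pose f (q : G * (G * G * G * G)) := (q.2.1.1.1, l1 q.1 q.2, l2 q.1 q.2,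
    l3 q.1 q.2, q.2.2 + (h q.1).2).
  rewrite -!cardsX -(card_in_imset (f := f)); last first.
    move=> [s x] [s' x']; rewrite !inE /= => /andP[sQ _] /andP[sQ' _].
    move=> [e1 e2 e3 e4 e5]; have [_ _ _ _ es] := hP _ sQ.
    have [_ _ _ _ es'] := hP _ sQ'.
    (* The links telescope: their sum is [s + x_1 - (x_4 + h_4)]. *)
    have sum_links t (y : G * G * G * G) :
        (h t).1.1.1 + (h t).1.1.2 + (h t).1.2 + (h t).2
        = l1 t y + l2 t y + l3 t y + (y.2 + (h t).2) - y.1.1.1.
      apply: (addIr y.1.1.1); rewrite subrK.
      have E3 : l3 t y + (y.2 + (h t).2) = y.1.2 + ((h t).1.2 + (h t).2).
        by rewrite /l3 subrKA addrA.
      have E2 u : l2 t y + (y.1.2 + u) = y.1.1.2 + ((h t).1.1.2 + u).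
        by rewrite /l2 subrKA addrA.
      have E1 u : l1 t y + (y.1.1.2 + u) = y.1.1.1 + ((h t).1.1.1 + u).
        by rewrite /l1 subrKA addrA.
      by rewrite -[RHS]addrA E3 -[RHS]addrA E2 E1 [LHS]addrC !addrA.
    have ss : s = s'.
      by rewrite es es' (sum_links _ x) (sum_links _ x') e1 e2 e3 e4 e5.
    move: e1 e2 e3 e4; rewrite -{}ss /l1 /l2 /l3 {es es' e5}.
    case: x x' => [[[? ?] ?] ?] [[[? ?] ?] ?] /= -> /addrI/oppr_inj ->.
    by move=> /addrI/oppr_inj -> /addrI/oppr_inj ->.
  apply: subset_leq_card; apply/subsetP => y /imsetP[[s x]].
  rewrite inE /= => /andP[_]; rewrite inE => /andP[/memall[[? _ _ _] [_ _ _ ?]]].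
  by move=> /and3P[? ? ?] ->; rewrite !inE /=; do !(apply/andP; split => //).
have cA : 0 < #|A|%:R :> R by rewrite ltr0n card_gt0.
rewrite -(ler_pM2l (exprn_gt0 2 cA)).
apply: le_trans (_ : #|T|%:R <= _).
  by apply: le_trans cT; rewrite le_eqVlt; apply/orP; left; apply/eqP; ring.
apply: le_trans (_ : (#|A| * #|D| * #|D| * #|D| * #|A|)%:R <= _).
  by rewrite ler_nat.
by rewrite !natrM le_eqVlt; apply/orP; left; apply/eqP; ring.
Qed.

(* Dependent random choice: if [b - b'] is not in [D] then few [a] have both
   [b] and [b'] as neighbours. *)
Lemma dependent_random_choice (eta ep tau : R) (S S' : {set G}) :
  0 < ep -> 0 < eta -> 0 <= tau -> S != set0 ->
  eta * #|S|%:R ^+ 2 <=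
    (\sum_(a in S) #|[set b in S | (b - a)%R \in S']|)%N%:R ->
  tau <= ep * eta ^+ 2 * #|S|%:R / 2 ->
  exists2 A : {set G}, A \subset S /\ eta ^+ 2 / 2 * #|S|%:R ^+ 2 <= #|A|%:R ^+ 2 &
    #|bad_pairs [set x | tau <= #|pop S' x|%:R] A|%:R <= ep * #|A|%:R ^+ 2.
Proof.
move=> ep0 eta0 tau0 S0 dens tau_le; set D := [set x | _].
pose Nb a := [set b in S | (b - a)%R \in S'].
have S_gt0 : 0 < #|S|%:R :> R by rewrite ltr0n card_gt0.
(* If [b - b'] is not in [D], then [a -> b' - a] embeds the common neighbours of [b] and [b'] into
   [pop S' (b - b')], which has fewer than [tau] elements. *)
have sumbad : \sum_(a in S) #|bad_pairs D (Nb a)|%:R <= #|S|%:R ^+ 2 * tau.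
  have -> : \sum_(a in S) #|bad_pairs D (Nb a)|%:R =
      (\sum_(q in setX S S) #|[set a in S | [&& (q.1 - a)%R \in S',
         (q.2 - a)%R \in S' & (q.1 - q.2)%R \notin D]]|)%N%:R :> R.
    rewrite -natr_sum sum_card_exchange; congr _%:R; apply: eq_bigr => a aS.
    apply: eq_card => -[b b']; rewrite !inE /=.
    by case: (b \in S); case: (b' \in S); rewrite //= ?andbF.
  rewrite natr_sum expr2 -natrM -cardsX mulr_natl -sumr_const.
  apply: ler_sum => -[b b'] _ /=; have [bbD|bbD] := boolP (b - b' \in D).
    by rewrite (_ : [set a in S | _] = set0) ?cards0 //; apply/setP => a;
      rewrite !inE !andbF.
  apply: le_trans (_ : #|pop S' (b - b')|%:R <= _); last first.
    by move: bbD; rewrite inE -ltNge => /ltW.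
  rewrite ler_nat -[leqLHS](card_imset _ (subrI b')); apply: subset_leq_card.
  apply/subsetP => y /imsetP[a]; rewrite !inE andbT => /and3P[_ bS bS'] ->.
  by rewrite bS' [b' - a + _]addrC subrKA.
have dens2 : eta ^+ 2 * #|S|%:R ^+ 3 <= \sum_(a in S) #|Nb a|%:R ^+ 2 :> R.
  rewrite -(ler_pM2l S_gt0); apply: le_trans (sqr_sum_le _ _).
  apply: le_trans (_ : (eta * #|S|%:R ^+ 2) ^+ 2 <= _).
    by rewrite le_eqVlt; apply/orP; left; apply/eqP; ring.
  by rewrite ler_sqr ?nnegrE ?mulr_ge0 ?(ltW eta0) ?sumr_ge0 // -natr_sum.
(* One averaging gives both conclusions: each of the two nonnegative terms on the left is at most
   [#|Nb a| ^+ 2]. *)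
have [a aS le_a] : exists2 a, a \in S &
    eta ^+ 2 / 2 * #|S|%:R ^+ 2 + #|bad_pairs D (Nb a)|%:R / ep <=
    #|Nb a|%:R ^+ 2 :> R.
  apply: exists_sum_le => //; apply: le_trans dens2.
  rewrite big_split /= sumr_const -mulr_suml -[_ *+ #|_|]mulr_natl.
  apply: le_trans (lerD (lexx _) (ler_wpM2r _ sumbad)) _.
    by rewrite invr_ge0 ltW.
  apply: le_trans (lerD (lexx _) (ler_wpM2r _ (ler_wpM2l _ tau_le))) _.
  - by rewrite invr_ge0 ltW.
  - exact: exprn_ge0.
  - rewrite le_eqVlt; apply/orP; left; apply/eqP; field; exact: lt0r_neq0.
have bad0 : 0 <= #|bad_pairs D (Nb a)|%:R / ep :> R by rewrite divr_ge0 // ltW.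
exists (Nb a); first split.
- by apply/subsetP => b; rewrite inE => /andP[].
- by apply: le_trans le_a; rewrite lerDl.
- rewrite -ler_pdivrMl // mulrC; apply: le_trans le_a.
  by rewrite lerDr mulr_ge0 ?exprn_ge0 // divr_ge0 ?exprn_ge0 // ltW.
Qed.

End PopularDifferences.

(** * Mass of positive definite functions on level sets and cosets *)

Section PositiveDefinite.
Variables (R : realType) (G : finZmodType) (F : G -> R).
Hypothesis F01 : forall x, 0 <= F x <= 1.
(** If [F (a - b)] is the inner product of vectors [v_a] and [v_b], with [F 0 <= 1], this is
    Cauchy-Schwarz between [v_0] and the sum of the [v_a]. *)
Hypothesis Fpd : forall A : {set G},
  (\sum_(a in A) F a) ^+ 2 <= \sum_(a in A) \sum_(b in A) F (a - b).

Let F0 x : 0 <= F x. Proof. by case/andP: (F01 x). Qed.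
Let F1 x : F x <= 1. Proof. by case/andP: (F01 x). Qed.

Definition level (t : R) : {set G} := [set x | t <= F x].

Lemma card_level t : t * #|level t|%:R <= \sum_x F x.
Proof.
rewrite -sumr_const mulr_sumr [leRHS](bigID (mem (level t))) /=.
apply: ler_wpDr; first exact: sumr_ge0.
by apply: ler_sum => x; rewrite inE mulr1.
Qed.

(** The hereditary property: pairs with [F (a - b)] below [c ^+ 2 / 2] account for at most half of
    the lower bound [c ^+ 2 * #|A| ^+ 2] given by [Fpd]. It is applied to a level set and again to a
    subset of it. *)
Lemma level_pairs (c : R) (A : {set G}) : 0 <= c -> A \subset level c ->
  c ^+ 2 / 2 * #|A|%:R ^+ 2 <=
  (\sum_(a in A) #|[set b in A | (b - a)%R \in level (c ^+ 2 / 2)]|)%N%:R.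
Proof.
move=> c0 AS; set S' := level _; set X := (X in _ <= X).
have sumA : c * #|A|%:R <= \sum_(a in A) F a.
  rewrite -sumr_const mulr_sumr; apply: ler_sum => a /(subsetP AS).
  by rewrite inE mulr1.
have : (c * #|A|%:R) ^+ 2 <= X + c ^+ 2 / 2 * #|A|%:R ^+ 2.
  apply: le_trans (_ : (\sum_(a in A) F a) ^+ 2 <= _).
    by rewrite ler_sqr ?nnegrE ?sumr_ge0 ?mulr_ge0.
  apply: le_trans (Fpd A) _; rewrite exchange_big /=.
  rewrite /X natr_sum [#|A|%:R ^+ 2]expr2 mulrA [_ * #|A|%:R * _]mulrC mulr_natl.
  rewrite -sumr_const -big_split /=; apply: ler_sum => a _.
  rewrite card_set_in natr_sum mulrC mulr_natl -sumr_const -big_split /=.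
  apply: ler_sum => b _; have [bS|bS] := boolP (b - a \in S').
    by rewrite (le_trans (F1 _)) // lerDl divr_ge0 ?exprn_ge0.
  by rewrite add0r ltW // ltNge; move: bS; rewrite inE.
by rewrite exprMn; lra.
Qed.

(** Apply [Fpd] to the coset [K + a]: its differences cover [K], each element [#|K|] times. *)
Lemma subgroup_mass_coset (K : {set G}) a : subgroup K ->
  (\sum_(x in K) F (x + a)) ^+ 2 <= #|K|%:R * \sum_(x in K) F x.
Proof.
move=> sK; have Ia : {in K &, injective (fun x => x + a)}.
  by move=> x y _ _ /addIr.
have := Fpd [set x + a | x in K]; rewrite (big_imset _ Ia) /=.
rewrite [X in _ <= X](big_imset _ Ia) /= => /le_trans; apply.
rewrite mulr_natl -sumr_const; apply: ler_sum => x xK.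
rewrite (big_imset _ Ia) /= [leRHS](reindex_inj (subrI x)) /= le_eqVlt.
apply/orP; left; apply/eqP; apply: eq_big => y; last first.
  by move=> _; rewrite opprD addrACA subrr addr0.
by rewrite -[in RHS]opprB (subgroup_opp sK) subgroup_subr.
Qed.

(** The mass of the coset [K + a] is at least [c] times its number of points in [A]. *)
Lemma subgroup_mass_subset (K A : {set G}) (c : R) : subgroup K -> 0 <= c ->
  A \subset level c ->
  forall a, c ^+ 2 * #|[set b in A | (b - a)%R \in K]|%:R ^+ 2 <=
    #|K|%:R * \sum_(x in K) F x.
Proof.
move=> sK c0 AS a; apply: le_trans (subgroup_mass_coset a sK).
rewrite -exprMn ler_sqr ?nnegrE ?mulr_ge0 ?sumr_ge0 //.
rewrite -sumr_const mulr_sumr.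
rewrite -(big_imset (fun x => F x)) /=; last by move=> x y _ _ /addIr.
rewrite [leRHS](bigID (mem A)) /=; apply: ler_wpDr; first exact: sumr_ge0.
rewrite [leRHS](eq_bigl (mem [set b in A | (b - a)%R \in K])) /=.
  by apply: ler_sum => b; rewrite mulr1 inE => /andP[/(subsetP AS)]; rewrite inE.
move=> b; rewrite !inE andbC; case: (b \in A) => //=.
apply/imsetP/idP => [[x xK ->]|bK]; first by rewrite addrK.
by exists (b - a); rewrite ?subrK.
Qed.

End PositiveDefinite.

(** [N] is the scale of all bounds; in the application [G] is [Z * Z] and [N] is [#|Z|]. *)
Lemma structured_subgroup (R : realType) (m : nat) (kap : R) :
  (0 < m)%N -> 0 < kap -> exists c C : R, [/\ 0 < c, 0 < C &
  forall (G : finZmodType) (N : R) (F : G -> R),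
    torsion m G -> 0 < N -> (forall x, 0 <= F x <= 1) ->
    (forall A : {set G},
      (\sum_(a in A) F a) ^+ 2 <= \sum_(a in A) \sum_(b in A) F (a - b)) ->
    \sum_x F x <= N -> kap * N <= \sum_x F x ^+ 2 ->
    exists K : {set G}, [/\ subgroup K, #|K|%:R <= C * N &
      c * N <= \sum_(x in K) F x]].
Proof.
(* [c] and [eta] are the levels of [S] and [S'], [al * N] bounds [#|A|] from below and [c1] is the
   popularity threshold of [H]. [CD], [C4] and [CK] bound [#|D|], [|4H|] and [#|K|] in units of [N],
   and [n] bounds [|4H| / |H|]. *)
move=> m0 kap0; pose c := kap / 2; have c0 : 0 < c by rewrite divr_gt0.
pose eta := c ^+ 2 / 2; have eta0 : 0 < eta by rewrite divr_gt0 // exprn_gt0.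
pose al := eta * c / 2; have al0 : 0 < al by rewrite divr_gt0 // mulr_gt0.
pose c1 := eta ^+ 2 * al / 2.
have c10 : 0 < c1 by rewrite divr_gt0 // mulr_gt0 // exprn_gt0.
pose ep := c1 ^+ 4 / 6; have ep0 : 0 < ep by rewrite divr_gt0 // exprn_gt0.
pose CD := 2 / (ep * eta ^+ 4 * c).
have CD0 : 0 < CD by rewrite divr_gt0 // mulr_gt0 // mulr_gt0 // exprn_gt0.
pose C4 := CD ^+ 3 / (c1 ^+ 4 / 2 * al ^+ 2).
have C40 : 0 < C4.
  rewrite divr_gt0 // ?exprn_gt0 // mulr_gt0 // ?exprn_gt0 //.
  by rewrite divr_gt0 // exprn_gt0.
pose n := (Num.truncn (C4 / (eta * al / 2))).+1.
pose CK := (m ^ n)%:R * C4.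
have CK0 : 0 < CK by rewrite mulr_gt0 // ltr0n expn_gt0 m0.
exists ((c * (eta / 2 * al)) ^+ 2 / CK), CK; split=> //.
  by rewrite divr_gt0 // exprn_gt0 // mulr_gt0 // mulr_gt0 // divr_gt0.
move=> G N F tG N0 F01 Fpd sumF sumF2.
have F0 x : 0 <= F x by case/andP: (F01 x).
have F1 x : F x <= 1 by case/andP: (F01 x).
pose S := level F c; pose S' := level F eta.
(* Points with [F x < c] contribute at most [c * N], half of [kap * N], to the sum of squares. *)
have S_ge : c * N <= #|S|%:R.
  have : \sum_x F x ^+ 2 <= #|S|%:R + c * \sum_x F x.
    rewrite -sumr_const [X in X + _]big_mkcond mulr_sumr -big_split /=.
    apply: ler_sum => x _; rewrite expr2; case: ifPn => [_|].
      rewrite (le_trans (ler_piMl (F0 x) (F1 x))) //.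
      by rewrite (le_trans (F1 x)) // lerDl mulr_ge0 // ltW.
    by rewrite inE -ltNge add0r => /ltW Fc; rewrite ler_wpM2r.
  have : c * \sum_x F x <= c * N by rewrite ler_pM2l.
  have cN : c * N + c * N = kap * N by rewrite /c; lra.
  by move: sumF2; rewrite -cN; lra.
have S_gt0 : 0 < #|S|%:R :> R by apply: lt_le_trans S_ge; rewrite mulr_gt0.
have S_neq0 : S != set0 by rewrite -card_gt0 -(ltr0n R).
have S'_le : eta * #|S'|%:R <= N by apply: le_trans sumF; exact: card_level.
pose tau := ep * eta ^+ 2 * #|S|%:R / 2.
have tau0 : 0 < tau by rewrite divr_gt0 // mulr_gt0 // mulr_gt0 // exprn_gt0.
have dens := level_pairs F01 Fpd (ltW c0).
have [A [AS A2_ge] bad] := dependent_random_choice ep0 eta0 (ltW tau0) S_neq0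
  (dens S (subxx _)) (lexx tau).
set D := [set x | _] in bad.
have A_ge : al * N <= #|A|%:R.
  rewrite -ler_sqr ?nnegrE //; last by rewrite mulr_ge0 // ltW.
  apply: le_trans A2_ge.
  have : (c * N) ^+ 2 <= #|S|%:R ^+ 2 
    by rewrite ler_sqr ?nnegrE // mulr_ge0 // ltW.
  move=> /(ler_wpM2l (ltW (divr_gt0 (exprn_gt0 2 eta0) (ltr0n R 2)))).
  apply: le_trans; have : 0 <= (eta * c * N) ^+ 2 by rewrite sqr_ge0.
  by rewrite /al !exprMn; lra.
have A_gt0 : 0 < #|A|%:R :> R := lt_le_trans (mulr_gt0 al0 N0) A_ge.
have A_neq0 : A != set0 by rewrite -card_gt0 -(ltr0n R).
(* Each element of [D] is a difference of at least [tau] of the [#|S'| ^+ 2] pairs in [S']. *)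
have D_le : #|D|%:R <= CD * N.
  have le1 : tau * #|D|%:R <= #|S'|%:R ^+ 2.
    rewrite -natrX -sum_pop_all natr_sum -sumr_const mulr_sumr.
    rewrite [leRHS](bigID (mem D)) /=; apply: ler_wpDr; first exact: sumr_ge0.
    by apply: ler_sum => x; rewrite inE mulr1.
  have h1 : eta ^+ 2 * (ep * eta ^+ 2 * (c * N) / 2 * #|D|%:R) <=
      eta ^+ 2 * (tau * #|D|%:R).
    rewrite ler_wpM2l ?exprn_ge0 ?(ltW eta0) // ler_wpM2r // /tau.
    rewrite ler_wpM2r ?invr_ge0 // ler_wpM2l // mulr_ge0 ?(ltW ep0) //.
    by rewrite exprn_ge0 // ltW.
  have h2 : (eta * #|S'|%:R) ^+ 2 <= N ^+ 2.
    by rewrite ler_sqr ?nnegrE ?(ltW N0) // mulr_ge0 // ltW.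
  have := ler_wpM2l (exprn_ge0 2 (ltW eta0)) le1.
  move=> /(le_trans h1); rewrite -exprMn => /le_trans/(_ h2) h3.
  rewrite mulrAC ler_pdivlMr; last by rewrite mulr_gt0 // mulr_gt0 // exprn_gt0.
  rewrite -(ler_pM2r N0); move: h3; clear; lra.
pose H := [set x | c1 * #|A|%:R <= #|pop A x|%:R].
have H0 : 0 \in H.
  rewrite inE (_ : pop A 0 = A); last first.
    by apply/setP => a; rewrite inE addr0 andbb.
  rewrite ler_piMl //.
  (* As [F ^+ 2 <= F], the two sum hypotheses force [kap <= 1], hence [c1 <= 1]. *)
  have kap1 : kap <= 1.
    rewrite -(ler_pM2r N0) mul1r; apply: le_trans sumF2 _.
    apply: le_trans sumF; apply: ler_sum => x _.
    by rewrite expr2 ler_piMl.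
  have c_le1 : c <= 1 by rewrite /c; lra.
  have eta_le1 : eta <= 1 by rewrite /eta; have := exprn_ile1 2 (ltW c0) c_le1; lra.
  have al_le1 : al <= 1.
    by rewrite /al; have := mulr_ile1 (ltW eta0) (ltW c0) eta_le1 c_le1; lra.
  have := mulr_ile1 (exprn_ge0 2 (ltW eta0)) (ltW al0)
    (exprn_ile1 2 (ltW eta0) eta_le1) al_le1.
  by rewrite /c1; lra.
have HN x : x \in H -> - x \in H by rewrite !inE popN.
have H4_le : #|sumset (sumset (sumset H H) H) H|%:R <= C4 * N.
  have popH x : x \in H -> c1 * #|A|%:R <= #|pop A x|%:R by rewrite inE.
  have := card_fourfold_sumset c10 A_neq0 popH bad.
  set X := #|_|%:R => le1.
  have c14 : 0 < c1 ^+ 4 / 2 by rewrite divr_gt0 // exprn_gt0.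
  have A2 : (al * N) ^+ 2 <= #|A|%:R ^+ 2.
    by rewrite ler_sqr ?nnegrE // mulr_ge0 // ltW.
  have D3 : #|D|%:R ^+ 3 <= (CD * N) ^+ 3.
    by rewrite lerXn2r ?nnegrE // mulr_ge0 // ltW.
  have := ler_wpM2l (ler0n R #|sumset (sumset (sumset H H) H) H|)
    (ler_wpM2l (ltW c14) A2).
  move=> /le_trans/(_ le1)/le_trans/(_ D3) le2.
  rewrite mulrAC ler_pdivlMr; last by rewrite mulr_gt0 // exprn_gt0.
  rewrite -(ler_pM2r (exprn_gt0 2 N0)); move: le2; rewrite -/X; clear; lra.
(* Among the [eta * #|A| ^+ 2] pairs with difference in [S'], at most [#|S'| * (c1 * #|A|)] have
   their difference outside [H]; [c1] makes this at most half. *)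
have pairs_ge : eta / 2 * #|A|%:R ^+ 2 <= (\sum_(x in H) #|pop A x|)%N%:R.
  have := dens A AS; rewrite -sum_pop -/eta -/S' !natr_sum => le1.
  have : \sum_(x in S') #|pop A x|%:R <=
      \sum_(x in H) #|pop A x|%:R + #|S'|%:R * (c1 * #|A|%:R).
    rewrite [leLHS](bigID (mem H)) /= lerD //.
      rewrite [leRHS](bigID (mem S')) /= ler_wpDr ?sumr_ge0 //.
      by under eq_bigl do rewrite andbC.
    rewrite [leRHS]mulr_natl -sumr_const [leRHS](bigID (mem H)) /= ler_wpDl //.
      by apply: sumr_ge0 => x _; rewrite mulr_ge0 // ltW.
    by apply: ler_sum => x /andP[_]; rewrite inE -ltNge => /ltW.
  have S'A : eta * #|S'|%:R * al <= #|A|%:R.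
    by apply: le_trans A_ge; rewrite mulrC ler_pM2l.
  have : #|S'|%:R * (c1 * #|A|%:R) <= eta / 2 * #|A|%:R ^+ 2.
    have := ler_wpM2r (ltW A_gt0) (ler_wpM2l (ltW eta0) S'A).
    by rewrite /c1; lra.
  by move: le1; clear; lra.
have H_ge : eta / 2 * #|A|%:R <= #|H|%:R.
  rewrite -(ler_pM2r A_gt0).
  have -> : eta / 2 * #|A|%:R * #|A|%:R = eta / 2 * #|A|%:R ^+ 2 by ring.
  apply: le_trans pairs_ge _.
  rewrite mulr_natl -sumr_const natr_sum; apply: ler_sum => x _.
  by rewrite ler_nat subset_leq_card //; apply/subsetP => a; rewrite inE => /andP[].
have [K [sK HK K_le]] : exists K, [/\ subgroup K, H \subset K &
    (#|K| <= m ^ n * #|sumset (sumset (sumset H H) H) H|)%N].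
  apply: covering_subgroup => //.
  rewrite -(ler_nat R) natrM; apply: le_trans H4_le _.
  have ea0 : 0 < eta * al / 2 by rewrite divr_gt0 // mulr_gt0.
  have -> : C4 * N = C4 / (eta * al / 2) * (eta / 2 * (al * N)).
    by field; rewrite !lt0r_neq0.
  apply: ler_pM.
  - by rewrite divr_ge0 // ltW.
  - by apply: mulr_ge0; [apply: divr_ge0|apply: mulr_ge0]; rewrite // ltW.
  - by rewrite ltW // truncnS_gt.
  - by apply: le_trans H_ge; rewrite ler_wpM2l // divr_ge0 // ltW.
have {}K_le : #|K|%:R <= CK * N.
  apply: le_trans (_ : (m ^ n)%:R * (C4 * N) <= _); last by rewrite mulrA.
  by apply: le_trans (ler_wpM2l _ H4_le) => //; rewrite -natrM ler_nat.
exists K; split=> //.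
(* Differences in [H] lie in [K], so on average over [a] the coset [a + K] is rich in points of
   [A]. *)
have [a aA a_le] : exists2 a, a \in A &
    eta / 2 * #|A|%:R <= #|[set b in A | (b - a)%R \in K]|%:R.
  apply: exists_sum_le => //.
  rewrite -natr_sum -sum_pop sumr_const -[_ *+ #|_|]mulr_natr.
  have -> : eta / 2 * #|A|%:R * #|A|%:R = eta / 2 * #|A|%:R ^+ 2 by ring.
  apply: le_trans pairs_ge _; rewrite ler_nat [leqRHS](bigID (mem H)) /=.
  apply: leq_trans (leq_addr _ _).
  rewrite [leqRHS](eq_bigl (fun x => x \in H)) // => x.
  by apply/andP/idP => [[]//|xH]; rewrite (subsetP HK).
have := subgroup_mass_subset F01 Fpd sK (ltW c0) AS a.
set X := #|[set b in A | _]|%:R in a_le *; set Y := \sum_(x in K) F x => le1.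
have Y0 : 0 <= Y by exact: sumr_ge0.
have X_ge : eta / 2 * al * N <= X.
  by apply: le_trans a_le; rewrite -mulrA ler_wpM2l // divr_ge0 // ltW.
have z0 : 0 <= eta / 2 * al * N.
  apply: mulr_ge0; last exact: ltW.
  by apply: mulr_ge0; [apply: divr_ge0|]; rewrite // ltW.
have X2 : (eta / 2 * al * N) ^+ 2 <= X ^+ 2 by rewrite ler_sqr ?nnegrE.
have := le_trans (ler_wpM2l (exprn_ge0 2 (ltW c0)) X2) le1.
move=> /le_trans/(_ (ler_wpM2r Y0 K_le)) le2.
rewrite mulrAC ler_pdivrMr // -(ler_pM2r N0); move: le2; clear; lra.
Qed.

(** * Constructions from a basis *)

Section Basis.
Variable Z : finZmodType.

(** [Z] is the direct sum of the cyclic groups generated by the [b i]. The coordinates [a i x] are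
    natural numbers, meaningful only modulo the order [d i]. *)
Definition basis (n : nat) (b : 'I_n -> Z) (d : 'I_n -> nat)
    (a : 'I_n -> Z -> nat) : Prop :=
  [/\ forall i, (0 < d i)%N,
      forall i k, (b i *+ k == 0) = (d i %| k)%N,
      forall x, x = \sum_i b i *+ a i x,
      forall i x y, a i (x + y) = (a i x + a i y)%N %[mod d i] &
      forall i j, a i (b j) = (i == j) %[mod d i]].

Lemma basis_exists : exists n b d a, @basis n b d a.
Proof.
have abZ : abelian [set: Z] by apply/centsP => x _ y _; exact: addrC.
have [s sZ _] := abelian_structure abZ.
rewrite big_tnth in sZ.
pose b i := tnth (in_tuple s) i; pose d i := #[b i]%g.
(* Uniqueness of coordinates in the direct product; the last two clauses of [basis] follow from
   it. *)
have inj (k l : 'I_(size s) -> nat) : \sum_i b i *+ k i = \sum_i b i *+ l i ->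
    forall i, k i = l i %[mod d i].
  move=> kl i; apply/eqP; rewrite -eq_expg_mod_order !zmodXgE; apply/eqP.
  have [c [_ _ cU]] := mem_bigdprod sZ (in_setT (\sum_i b i *+ k i)).
  rewrite (cU (fun i => b i *+ k i)) ?(cU (fun i => b i *+ l i)) //.
  - by move=> j _; rewrite -zmodXgE mem_cycle.
  - by move=> j _; rewrite -zmodXgE mem_cycle.
have [a aP] : exists a : Z -> {ffun 'I_(size s) -> nat},
    forall x, x = \sum_i b i *+ a x i.
  apply: (fin_all_exists (P := fun x (a : {ffun _ -> nat}) =>
    x = \sum_i b i *+ a i)) => x.
  have [c [cb -> _]] := mem_bigdprod sZ (in_setT x).
  have [k kP] : exists k : 'I_(size s) -> nat, forall i, c i = b i *+ k i.
    apply: (fin_all_exists (P := fun i k => c i = b i *+ k)) => i.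
    by have /cycleP[k ->] := cb i isT; exists k; rewrite zmodXgE.
  exists [ffun i => k i]; apply: eq_bigr => i _; by rewrite ffunE kP.
exists (size s), b, d, (fun i x => a x i); split.
- by move=> i; exact: order_gt0.
- by move=> i k; rewrite -zmodXgE order_dvdn.
- exact: aP.
- move=> i x y; apply: (inj (a (x + y)) (fun i => (a x i + a y i)%N)).
  rewrite -aP {1}[x]aP {1}[y]aP -big_split /=.
  by apply: eq_bigr => j _; rewrite mulrnDr.
- move=> i j; apply: (inj (a (b j)) (fun i => nat_of_bool (i == j))).
  rewrite -aP (bigD1 j) //= eqxx big1 ?addr0 // => k /negbTE ->.
  by rewrite mulr0n.
Qed.

End Basis.

Lemma mulrn_mod (V : zmodType) (t : V) (d k l : nat) :
  t *+ d = 0 -> k = l %[mod d] -> t *+ k = t *+ l.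
Proof.
move=> td kl; rewrite (divn_eq k d) (divn_eq l d) kl !mulrnDr.
by rewrite ![(_ * d)%N]mulnC !mulrnA td !mul0rn.
Qed.

Lemma sum_lower_triangle (V : nmodType) n (c : 'I_n -> 'I_n -> V) :
  \sum_i \sum_j c i j =
  \sum_(i < n) \sum_(j < n | (j < i)%N) (c i j + c j i) + \sum_i c i i.
Proof.
under [X in _ = X + _]eq_bigr do rewrite big_split /=.
rewrite big_split /= [X in _ = _ + X + _](exchange_big_dep xpredT) //=.
rewrite -addrA -!big_split /=; apply: eq_bigr => i _.
rewrite (bigID (fun j : 'I_n => (j < i)%N)) /=; congr (_ + _).
rewrite (bigD1 i) ?ltnn //= addrC; congr (_ + _).
by apply: eq_bigl => j; rewrite -leqNgt ltn_neqAle andbC eq_sym.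
Qed.

Section BasisConstructions.
Variables (R : realType) (Z : finZmodType).
Variables (n : nat) (b : 'I_n -> Z) (d : 'I_n -> nat) (a : 'I_n -> Z -> nat).
Hypothesis bP : basis b d a.

Let d_gt0 i : (0 < d i)%N. Proof. by case: bP. Qed.
Let bd i k : (b i *+ k == 0) = (d i %| k)%N. Proof. by case: bP. Qed.
Let ab x : x = \sum_i b i *+ a i x. Proof. by case: bP. Qed.
Let aD i x y : a i (x + y) = (a i x + a i y)%N %[mod d i].
Proof. by case: bP. Qed.
Let aE i j : a i (b j) = (i == j) %[mod d i]. Proof. by case: bP. Qed.

(** The sum of [x_i y_i / d_i] modulo 1, which identifies [Z] with its dual by a choice of basis. *)
Definition pairing (x y : Z) : circle R :=
  \sum_i toC (d i)%:R^-1 *+ (a i x * a i y).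

Let toC_d i : toC (d i)%:R^-1 *+ d i = 0 :> circle R.
Proof.
rewrite -(morphDMn (@toCD R)); apply/eqP; rewrite toC_eq0 -[_ *+ d i]mulr_natl divff //.
by rewrite pnatr_eq0 -lt0n.
Qed.

Lemma pairingC x y : pairing x y = pairing y x.
Proof. by apply: eq_bigr => i _; rewrite mulnC. Qed.

Lemma pairingDr x : {morph pairing x : y z / y + z}.
Proof.
move=> y z; rewrite /pairing -big_split; apply: eq_bigr => i _ /=.
rewrite -mulrnDr -mulnDr; apply: mulrn_mod (toC_d i) _.
by rewrite -modnMmr aD modnMmr.
Qed.

(** Pairing with [b i] gives [a i x / d i], which is an integer only if [b i *+ a i x = 0]. *)
Lemma pairing_nondegenerate x : (forall y, pairing x y = 0) -> x = 0.
Proof.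
move=> x0; rewrite [x]ab big1 // => i _; apply/eqP; rewrite bd.
have := x0 (b i); rewrite /pairing (bigD1 i) //= big1 => [|j ji]; last first.
  rewrite (mulrn_mod (toC_d j) (l := 0)) // -modnMmr aE (negbTE ji).
  by rewrite /= mod0n muln0 mod0n.
rewrite addr0 (mulrn_mod (toC_d i) (l := a i x)); last first.
  by rewrite -modnMmr aE eqxx modnMmr muln1.
rewrite -(morphDMn (@toCD R)) => /eqP; rewrite toC_eq0 => /intrP[z].
rewrite -[_ *+ a i x]mulr_natl => /(congr1 (fun t => t * (d i)%:R)).
rewrite divfK; last by rewrite pnatr_eq0 -lt0n.
rewrite !pmulrn -intrM => /intr_inj E.
by apply/dvdnP; exists `|z|%N; rewrite -[LHS]absz_nat E abszM absz_nat.
Qed.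

(* [i |-> t (i^2 + k i) / 2], halved in [R]: for even [k] its values need not be
   [k]-torsion, which is where non-classical polynomials come from. *)
Lemma cyclic_quadratic (t : circle R) (k : nat) : t *+ k = 0 ->
  exists s : nat -> circle R, s k = 0 /\
    forall i j, s (i + j)%N = s i + s j + t *+ (i * j).
Proof.
have [r ->] := circle_lift t => tk.
(* The linear term makes the value at [k] equal to [r * k ^+ 2], an integer because [r * k] is
   one. *)
exists (fun i => toC (r * (i%:R ^+ 2 + k%:R * i%:R) / 2)); split.
  rewrite (_ : _ / 2 = r *+ k *+ k).
    by rewrite (morphDMn (@toCD R)) (morphDMn (@toCD R)) tk mul0rn.
  by rewrite -[_ *+ k]mulr_natr -[r *+ k]mulr_natr; field.
move=> i j; rewrite -(morphDMn (@toCD R)) -!toCD; congr toC.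
by rewrite -[r *+ _]mulr_natr natrM natrD; field.
Qed.

(** Off the diagonal, the terms of [B x y] pair up into the polarisation of
    [t i j *+ (a i x * a j x)] with [j < i]. Halving is needed only on the diagonal, where
    [cyclic_quadratic] provides it. *)
Lemma symmetric_form_integrable (B : Z -> Z -> circle R) :
  (forall x, {morph B x : y z / y + z}) -> (forall x y, B x y = B y x) ->
  exists Q : Z -> circle R, forall x y, Q (x + y) = Q x + Q y + B x y.
Proof.
move=> BDr BC; have BDl z : {morph B^~ z : x y / x + y}.
  by move=> x y; rewrite !(BC _ z) BDr.
pose t i j := B (b i) (b j).
have tdr i j : t i j *+ d j = 0.
  rewrite /t -(morphDMn (BDr _)) (eqP (_ : b j *+ d j == 0)) ?(morphD0 (BDr _)) //.
  by rewrite bd.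
have tdl i j : t i j *+ d i = 0 by rewrite /t BC tdr.
have [s sP] : exists s : 'I_n -> nat -> circle R, forall i, s i (d i) = 0 /\
    forall k l, s i (k + l)%N = s i k + s i l + t i i *+ (k * l).
  apply: (fin_all_exists (P := fun i si => si (d i) = 0 /\
    forall k l, si (k + l)%N = si k + si l + t i i *+ (k * l))) => i.
  exact: cyclic_quadratic.
(* [s i] descends to residues modulo [d i]: it vanishes at multiples of [d i], which also kill the
   cross term. *)
have s_mod i k l : k = l %[mod d i] -> s i k = s i l.
  have [sd sD] := sP i; have s0 q : s i (q * d i)%N = 0.
    elim: q => [|q IH].
      rewrite mul0n; apply: (addrI (s i 0%N)).
      by have := sD 0%N 0%N; rewrite addn0 mulr0n !addr0 => <-.
    by rewrite mulSn sD sd IH !add0r mulrnA tdr mul0rn.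
  have E k' : s i k' = s i (k' %% d i)%N.
    rewrite {1}(divn_eq k' (d i)) sD s0 add0r mulnAC mulnC mulrnA tdr.
    by rewrite mul0rn addr0.
  by rewrite (E k) (E l) => ->.
pose Q x := \sum_(i < n) \sum_(j < n | (j < i)%N) t i j *+ (a i x * a j x) +
  \sum_i s i (a i x).
exists Q => x y.
have -> : B x y = \sum_i \sum_j t i j *+ (a i x * a j y).
  rewrite {1}[x]ab (morphD_sum (BDl y)); apply: eq_bigr => i _.
  rewrite {1}[y]ab (morphD_sum (BDr _)); apply: eq_bigr => j _.
  by rewrite (morphDMn (BDr _)) (morphDMn (BDl _)) mulrnA.
rewrite sum_lower_triangle /Q [X in _ = X + _]addrACA [RHS]addrACA.
congr (_ + _); rewrite -!big_split; apply: eq_bigr => i _ /=.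
  rewrite -!big_split; apply: eq_bigr => j _ /=.
  rewrite (_ : t j i = t i j) 1?[(a j x * _)%N]mulnC; last exact: BC.
  rewrite mulrnA (mulrn_mod (tdl i j) (aD i x y)) mulrnAC.
  rewrite (mulrn_mod (tdr i j) (aD j x y)) mulrnAC -mulrnA.
  rewrite mulnDl !mulnDr !mulrnDr [RHS]addrACA; congr (_ + _); exact: addrC.
by have [_ <-] := sP i; exact: s_mod (aD _ _ _).
Qed.

(* Send each [b i] to a representative of its class, where [b i] and [b j] are
   equivalent if they have the same order and the same image modulo [H]. *)
Lemma bounded_retraction (m k : nat) (H : {set Z}) :
  (0 < m)%N -> torsion m Z -> subgroup H -> (#|Z| <= k * #|H|)%N ->
  exists rho : Z -> Z, [/\ {morph rho : x y / x + y},
    forall x, x - rho x \in H & (#|rho @: [set: Z]| <= m ^ (m.+1 * k))%N].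
Proof.
move=> m0 tZ sH indexH.
have dm i : (d i <= m)%N by apply: dvdn_leq => //; rewrite -bd tZ.
pose eqv i j := (d j == d i) && (b i - b j \in H).
have eqv_sym i j : eqv i j -> eqv j i.
  by move=> /andP[/eqP dij bij]; rewrite /eqv dij eqxx -opprB subgroup_opp.
have eqv_trans i j l : eqv i j -> eqv j l -> eqv i l.
  rewrite /eqv => /andP[/eqP <- bij] /andP[/eqP -> bjl]; rewrite eqxx /=.
  by rewrite -(subrK (b j) (b i)) -addrA subgroupD.
(* Equivalent indices present the same predicate to [pick], so [r] is constant on classes;
   reflexivity rules out the default. *)
pose r i := odflt i [pick j | eqv i j].
have eqv_r i : eqv i (r i).
  rewrite /r; case: pickP => //= /(_ i).
  by rewrite /eqv eqxx subrr subgroup0.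
have r_eq i j : eqv i j -> r i = r j.
  move=> ij; rewrite /r (eq_pick (Q := eqv j)); last first.
    move=> l; apply/idP/idP; apply: eqv_trans => //; exact: eqv_sym.
  by case: pickP => // /(_ (r j)); rewrite eqv_r.
(* Coordinates are additive only modulo [d i]; equal orders of [b (r i)] and [b i] make [rho]
   additive. *)
pose rho x := \sum_i b (r i) *+ a i x.
have rhoD : {morph rho : x y / x + y}.
  move=> x y; rewrite /rho -big_split; apply: eq_bigr => i _ /=.
  rewrite -mulrnDr; apply: mulrn_mod (aD i x y).
  by apply/eqP; rewrite bd; case/andP: (eqv_r i) => /eqP ->.
exists rho; split=> //.
  move=> x; rewrite {1}[x]ab /rho -sumrB.
  elim/big_rec: _ => [|i y _ yH]; first exact: subgroup0.
  rewrite subgroupD // -mulrnBl; case/andP: (eqv_r i) => _ bH.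
  elim: (a i x) => [|l IH]; first by rewrite mulr0n subgroup0.
  by rewrite mulrS subgroupD.
pose reps := [set r i | i in 'I_n].
(* For a representative [i] and [h] in [H], the order [d i] and the element [b i + h] determine both
   [i] and [h]. Orders go up to [m] inclusive, hence the factor [m.+1]. *)
have card_reps : (#|reps| <= m.+1 * k)%N.
  have H0 : (0 < #|H|)%N by exact: subgroup_card_gt0.
  rewrite -(leq_pmul2r H0) -mulnA; apply: leq_trans (leq_mul (leqnn _) indexH).
  rewrite -[X in (_ <= X * _)%N]card_ord -card_prod -cardsX.
  pose f (q : 'I_n * Z) := (inord (d q.1) : 'I_m.+1, b q.1 + q.2).
  rewrite -(card_in_imset (f := f)) ?max_card //.
  move=> [i h] [j h'] /setXP[/= iR hH] /setXP[/= jR hH'] [/(congr1 val)].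
  rewrite /= !inordK ?ltnS // => dij E.
  have ij : eqv i j.
    rewrite /eqv dij eqxx /= (_ : b i - b j = h' - h) ?subgroupB //.
    by apply: (addIr h); rewrite subrK addrAC E addrAC subrr add0r.
  have rr l : l \in reps -> r l = l.
    by move=> /imsetP[l0 _ ->]; rewrite -(r_eq _ _ (eqv_r l0)).
  by move: E; rewrite -(rr i iR) (r_eq _ _ ij) (rr j jR) => /addrI ->.
have [V [V0 VD cV]] := torsion_span [seq b i | i <- enum reps] m0 tZ.
rewrite size_map -cardE in cV.
apply: leq_trans (_ : #|V| <= _)%N; last first.
  by apply: leq_trans cV _; rewrite leq_pexp2l.
apply: subset_leq_card; apply/subsetP => _ /imsetP[x _ ->].
rewrite /rho; elim/big_rec: _ => // i y _ yV; rewrite addrC.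
elim: (a i x) => [|l IH]; first by rewrite mulr0n addr0.
by rewrite mulrSr addrA VD // map_f // mem_enum imset_f.
Qed.

End BasisConstructions.

(** * Fourier analysis and the ambiguity function *)

Lemma prod_bool3 (V : comPzRingType) (F : bool * bool * bool -> V) :
  \prod_v F v =
  F (true, true, true) * F (true, true, false) *
  (F (true, false, true) * F (true, false, false)) *
  (F (false, true, true) * F (false, true, false) *
  (F (false, false, true) * F (false, false, false))).
Proof.
rewrite (eq_bigr (fun v => F (v.1, v.2))); last by case.
rewrite -(pair_bigA _ (fun q b => F (q, b))) /=.
rewrite (eq_bigr (fun q => \prod_b F (q.1, q.2, b))); last by case.
rewrite -(pair_bigA _ (fun a b => \prod_c F (a, b, c))) /=.
by rewrite !big_bool.
Qed.

Section Fourier.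
Variables (R : realType) (Z : finZmodType) (p : Z -> Z -> circle R).
Hypothesis pC : forall x y, p x y = p y x.
Hypothesis pDr : forall x, {morph p x : y z / y + z}.
Hypothesis p_nondeg : forall x, (forall y, p x y = 0) -> x = 0.

Let pDl z : {morph p^~ z : x y / x + y}.
Proof. by move=> x y; rewrite !(pC _ z) pDr. Qed.

Local Notation N := (#|Z|%:R).
Implicit Type g : Z -> R[i].

Lemma subgroupT : subgroup [set: Z].
Proof. by split=> *; rewrite inE. Qed.

Lemma card_gt0_Z : 0 < N :> R.
Proof. by rewrite ltr0n; apply/card_gt0P; exists 0. Qed.

Lemma sum_le_card (F : Z -> R) : (forall x, F x <= 1) -> \sum_x F x <= N.
Proof.
move=> F1; apply: le_trans (ler_sum _ (fun x _ => F1 x)) _.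
by rewrite sumr_const.
Qed.

Lemma orthogonality x : \sum_xi e (p xi x) = N *+ (x == 0) :> R[i].
Proof.
transitivity (\sum_(xi in [set: Z]) e (p xi x)).
  by apply: eq_bigl => xi; rewrite inE.
rewrite (character_sum subgroupT) => [|y z _ _]; last exact: pDl.
rewrite cardsT; congr (_ *+ _); congr nat_of_bool.
apply/forall_inP/eqP => [x0|-> y _]; last by rewrite (morphD0 (pDr y)).
by apply: p_nondeg => y; rewrite pC; apply/eqP; apply: x0; rewrite inE.
Qed.

(** The unnormalised Fourier transform, with frequencies in [Z] through [p]. *)
Definition hat g xi : R[i] := \sum_x g x * e (- p xi x).
Definition acorr g h : R[i] := \sum_x g (x + h) * (g x)^*%C.

Lemma parseval g : \sum_xi sqm (hat g xi) = N * \sum_x sqm (g x).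
Proof.
apply: complexI; rewrite rmorphM /= !real_complex_sum.
under eq_bigr do rewrite sqm_sum.
rewrite exchange_big mulr_sumr; apply: eq_bigr => x _ /=.
rewrite exchange_big (bigD1 x) //= [X in _ + X]big1 ?addr0.
  under eq_bigr do rewrite rmorphM /= mulrACA -eB subrr e0 mulr1.
  by rewrite sumr_const sqm_conj rmorph_nat mulr_natl.
move=> y yx; under eq_bigr do
  rewrite rmorphM /= mulrACA -eB -opprD -(morphDB (pDr _)) -(morphDN (pDr _)).
rewrite -mulr_sumr orthogonality oppr_eq0 subr_eq0 eq_sym (negbTE yx).
by rewrite mulr0.
Qed.

Lemma hat_acorr g xi : hat (acorr g) xi = (sqm (hat g xi))%:C.
Proof.
rewrite [in LHS]/hat /acorr; under eq_bigr do rewrite mulr_suml.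
rewrite exchange_big [hat g xi]/hat sqm_sum [RHS]exchange_big.
apply: eq_bigr => x _; rewrite (reindex_inj (addrI (- x))).
apply: eq_bigr => y _; rewrite addrA subrr add0r rmorphM /= mulrACA -eN -eD.
congr (_ * e _).
by rewrite pDr (morphDN (pDr _)) opprD !opprK addrC.
Qed.

(** Parseval for [acorr g]. Both sides are [N ^+ 4] times the fourth power of the U^2 norm of
    [g]. *)
Lemma sum_sqm_acorr g :
  N * \sum_h sqm (acorr g h) = \sum_xi sqm (hat g xi) ^+ 2.
Proof.
by rewrite -parseval; apply: eq_bigr => xi _; rewrite hat_acorr sqm_real.
Qed.

(** * The ambiguity function and its positive definiteness *)

Section AmbiguityFunction.
Variable f : Z -> R[i].
Hypothesis f1 : forall x, sqm (f x) <= 1.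

Definition mder h x : R[i] := f (x + h) * (f x)^*%C.
Definition amb (q : Z * Z) : R[i] := hat (mder q.1) q.2.
(** The function [F] of the overview. *)
Definition spec (q : Z * Z) : R := sqm (amb q) / N ^+ 2.

Let N0 := card_gt0_Z.

Lemma mder1 h x : sqm (mder h x) <= 1.
Proof. by rewrite sqmM sqmJ mulr_ile1 ?sqm_ge0. Qed.

Lemma sqm_amb q : sqm (amb q) = N ^+ 2 * spec q.
Proof. by rewrite /spec mulrC divfK // expf_neq0 // lt0r_neq0. Qed.

Lemma sqm_amb_le q : sqm (amb q) <= N ^+ 2.
Proof.
apply: le_trans (sqm_sum_le_card _ _) _.
rewrite expr2 ler_wpM2l //.
by apply: sum_le_card => x; rewrite sqmM sqm_e mulr1 mder1.
Qed.

Lemma spec01 q : 0 <= spec q <= 1.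
Proof.
rewrite divr_ge0 ?sqm_ge0 ?exprn_ge0 //= ler_pdivrMr ?exprn_gt0 // mul1r.
exact: sqm_amb_le.
Qed.

Lemma sum_spec_fiber h : \sum_xi spec (h, xi) <= 1.
Proof.
rewrite -mulr_suml (parseval (mder h)) ler_pdivrMr ?exprn_gt0 // mul1r expr2.
rewrite ler_wpM2l //.
by apply: sum_le_card => x; exact: mder1.
Qed.

Lemma sum_pairs (V : nmodType) (u : Z * Z -> V) :
  \sum_q u q = \sum_h \sum_xi u (h, xi).
Proof. by rewrite pair_bigA; apply: eq_bigr => -[]. Qed.

Lemma sum_spec : \sum_q spec q <= N.
Proof.
by rewrite sum_pairs; apply: sum_le_card => h; exact: sum_spec_fiber.
Qed.

(** The eighth power of the U^3 norm is the average over [h] of the fourth power of the U^2 norm of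
    [mder h], to which [sum_sqm_acorr] applies. *)
Lemma U3_avg_spec : U3_avg f = ((\sum_q spec q ^+ 2) / N)%:C.
Proof.
have -> : (\sum_q spec q ^+ 2) / N =
    (\sum_h \sum_k sqm (acorr (mder h) k)) / N ^+ 4 :> R.
  rewrite sum_pairs !mulr_suml; apply: eq_bigr => h _.
  have -> : \sum_k sqm (acorr (mder h) k) =
      (\sum_xi sqm (hat (mder h) xi) ^+ 2) / N.
    by rewrite -sum_sqm_acorr mulrC mulKf // lt0r_neq0.
  rewrite !mulr_suml; apply: eq_bigr => xi _; rewrite /spec /amb /=.
  by field; rewrite lt0r_neq0.
rewrite rmorphM /= real_complex_sum fmorphV rmorphXn /= rmorph_nat.
have U3E : U3_avg f = N ^- 4 * \sum_x \sum_h \sum_k \sum_l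
    mder h (x + k) * (mder h x)^*%C * (mder h (x + l + k) * (mder h (x + l))^*%C)^*%C.
  rewrite /U3_avg /avg.
  have -> : N ^- 4 = N^-1 * N^-1 * N^-1 * N^-1 :> R[i].
    by rewrite -!invfM; congr (_^-1); ring.
  rewrite -!mulrA; apply: congr1; rewrite !mulr_sumr; apply: eq_bigr => x _.
  apply: congr1; rewrite !mulr_sumr; apply: eq_bigr => h _.
  apply: congr1; rewrite !mulr_sumr; apply: eq_bigr => k _.
  apply: congr1; apply: eq_bigr => l _.
  have conjE z : Num.conj z = z^*%C :> R[i] by [].
  rewrite prod_bool3 /= /mder !rmorphM /= !mulr1n !mulr0n !addr0 !conjE !conjcK.
  rewrite [x + h + k + l]addrAC [x + h + l]addrAC [x + l + h + k]addrAC.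
  by rewrite [x + h + k]addrAC [x + k + l]addrAC; ring.
rewrite U3E mulrC; congr (_ * _); rewrite exchange_big; apply: eq_bigr => h _.
rewrite real_complex_sum exchange_big; apply: eq_bigr => k _.
rewrite sqm_sum; apply: eq_bigr => x _.
by rewrite [RHS](reindex_inj (addrI x)).
Qed.

(** Let [phi a] be [f] translated and modulated by [a]. The inner product of [phi a] and [phi b] is
    [amb (a - b)] up to a phase, so [N ^+ 2 * spec (a - b)] is the Gram matrix of the tensors
    [phi a] times conjugate [phi a]. Apply Cauchy-Schwarz to their sum [V] and the tensor built from
    [f]. *)
Lemma spec_pd (A : {set Z * Z}) :
  (\sum_(a in A) spec a) ^+ 2 <= \sum_(a in A) \sum_(b in A) spec (a - b).
Proof.
pose phi (a : Z * Z) u : R[i] := f (u + a.1) * e (- p a.2 u).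
have sqm_phi a b : sqm (\sum_u phi a u * (phi b u)^*%C) = N ^+ 2 * spec (a - b).
  rewrite -sqm_amb /amb /hat (reindex_inj (addIr (- b.1))) /=.
  have -> : \sum_u phi a (u - b.1) * (phi b (u - b.1))^*%C =
    e (p (a - b).2 b.1) * \sum_x mder (a - b).1 x * e (- p (a - b).2 x).
    rewrite mulr_sumr; apply: eq_bigr => u _; rewrite /phi /mder rmorphM /=.
    rewrite subrK -eN opprK -addrA [- b.1 + _]addrC mulrACA [RHS]mulrCA -!eD.
    congr (_ * e _); rewrite -[RHS]opprB -(morphDB (pDr _)).
    by rewrite (morphDB (pDl _)) opprB addrC.
  by rewrite sqmM sqm_e mul1r.
pose V (q : Z * Z) := \sum_(a in A) phi a q.1 * (phi a q.2)^*%C.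
have sum_V : (\sum_(a in A) N ^+ 2 * spec a)%:C =
    \sum_q V q * ((f q.1)^*%C * f q.2).
  rewrite real_complex_sum sum_pairs.
  under eq_bigr do rewrite -sqm_amb sqm_sum.
  rewrite exchange_big; apply: eq_bigr => u _.
  rewrite exchange_big; apply: eq_bigr => w _.
  rewrite mulr_suml; apply: eq_bigr => a _.
  by rewrite /mder /phi !rmorphM /= conjcK; ring.
have sum_V2 : \sum_q sqm (V q) = \sum_(a in A) \sum_(b in A) N ^+ 2 * spec (a - b).
  apply: complexI; rewrite !real_complex_sum.
  under eq_bigr do rewrite sqm_sum.
  under [RHS]eq_bigr do rewrite real_complex_sum.
  rewrite exchange_big; apply: eq_bigr => a _.
  rewrite exchange_big; apply: eq_bigr => b _.
  rewrite -sqm_phi sqm_conj conjc_sum mulr_suml sum_pairs; apply: eq_bigr => u _.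
  rewrite mulr_sumr; apply: eq_bigr => w _.
  by rewrite !rmorphM /= !conjcK; ring.
have sum_W : \sum_(q : Z * Z) sqm ((f q.1)^*%C * f q.2) <= N ^+ 2.
  rewrite sum_pairs expr2 mulr_natl -sumr_const; apply: ler_sum => u _.
  by apply: sum_le_card => w; rewrite sqmM sqmJ mulr_ile1 ?sqm_ge0.
have := cauchy_schwarz xpredT V (fun q => (f q.1)^*%C * f q.2).
rewrite -sum_V sqm_real sum_V2 => /le_trans le1.
have N2 : 0 < N ^+ 2 :> R by rewrite exprn_gt0.
have := le1 _ (ler_wpM2l _ sum_W).
under [X in 0 <= X]eq_bigr do rewrite -mulr_sumr.
under [X in _ -> _ <= X * _]eq_bigr do rewrite -mulr_sumr.
rewrite -!mulr_sumr => le2.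
rewrite -(ler_pM2l (mulr_gt0 N2 N2)) -expr2 -exprMn.
apply: le_trans (le2 _) _; last by rewrite mulrAC expr2.
rewrite mulr_ge0 ?(ltW N2) // sumr_ge0 // => a _; rewrite sumr_ge0 // => b _.
by case/andP: (spec01 (a - b)).
Qed.

End AmbiguityFunction.
End Fourier.

(** * The inverse theorem *)

Lemma card_le_image_kernel (G Z : finZmodType) (phi : G -> Z) (K : {set G}) :
  {morph phi : x y / x + y} -> subgroup K ->
  (#|K| <= #|phi @: K| * #|[set k in K | phi k == 0%R]|)%N.
Proof.
move=> phiD sK; rewrite -sum1_card (partition_big_imset phi) /=.
rewrite -sum_nat_const; apply: leq_sum => _ /imsetP[a aK ->].
rewrite sum1dep_card -(card_imset _ (addIr (- a))); apply: subset_leq_card.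
apply/subsetP => y /imsetP[k]; rewrite inE => /andP[kK /eqP pk] ->.
by rewrite inE subgroupB //= (morphDB phiD) pk subrr.
Qed.

(** Some coset of [K'] inside [K] carries at least the average mass; [subgroup_mass_coset] moves
    this mass to [K'] itself. *)
Lemma subgroup_mass_le (R : realType) (G : finZmodType) (F : G -> R)
    (K K' : {set G}) : (forall x, 0 <= F x <= 1) ->
  (forall A : {set G},
    (\sum_(a in A) F a) ^+ 2 <= \sum_(a in A) \sum_(b in A) F (a - b)) ->
  subgroup K -> subgroup K' -> K' \subset K ->
  #|K'|%:R * (\sum_(x in K) F x) ^+ 2 <= #|K|%:R ^+ 2 * \sum_(x in K') F x.
Proof.
move=> F01 Fpd sK sK' KK'; have K0 : 0 < #|K|%:R :> R.
  by rewrite ltr0n subgroup_card_gt0.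
have K'0 : 0 < #|K'|%:R :> R by rewrite ltr0n subgroup_card_gt0.
have F0 x : 0 <= F x by case/andP: (F01 x).
set s := \sum_(x in K) F x; have s0 : 0 <= s by exact: sumr_ge0.
have [a aK ale] : exists2 a, a \in K &
    #|K'|%:R * s / #|K|%:R <= \sum_(x in K') F (x + a).
  apply: exists_sum_le; first by apply/set0Pn; exists 0; exact: subgroup0.
  rewrite exchange_big sumr_const /= -[_ *+ #|_|]mulr_natr divfK ?lt0r_neq0 //.
  rewrite mulr_natl -sumr_const; apply: ler_sum => x xK'.
  under eq_bigr do rewrite addrC.
  by rewrite (sum_subgroup_shift sK) // (subsetP KK').
have := subgroup_mass_coset Fpd a sK'; apply: contraLR; rewrite -!ltNge => lt1.
apply: lt_le_trans (_ : (#|K'|%:R * s / #|K|%:R) ^+ 2 <= _); last first.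
  rewrite ler_sqr ?nnegrE ?sumr_ge0 //.
  by rewrite mulr_ge0 ?invr_ge0 // mulr_ge0.
rewrite exprMn exprVn ltr_pdivlMr ?exprn_gt0 //.
by move: lt1; rewrite -(ltr_pM2l K'0); clear; lra.
Qed.

(** The second differences of [P] are the constants [B c b]. *)
Lemma quadratic_poly_deg_le (Z V : zmodType) (P : Z -> V) (B : Z -> Z -> V) :
  (forall x, {morph B x : y z / y + z}) -> (forall x y, B x y = B y x) ->
  (forall x y, P (x + y) = P x + P y + B x y) -> poly_deg_le 2 P.
Proof.
move=> BDr BC PD [[|a [|b [|c []]]] // _] x /=.
have E z : fdiff c P z = P c + B c z.
  by rewrite /fdiff PD BC addrAC [P z + P c]addrC addrK.
have E2 z : fdiff b (fdiff c P) z = B c b.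
  rewrite -[LHS]/(fdiff c P (z + b) - fdiff c P z) !E BDr addrA.
  by rewrite [P c + _ + _]addrC addrK.
by rewrite -[LHS]/(fdiff b (fdiff c P) (x + a) - fdiff b (fdiff c P) x) !E2 subrr.
Qed.

Section Correlation.
Variables (R : realType) (Z : finZmodType) (p : Z -> Z -> circle R).
Hypothesis pC : forall x y, p x y = p y x.
Hypothesis pDr : forall x, {morph p x : y z / y + z}.
Hypothesis p_nondeg : forall x, (forall y, p x y = 0) -> x = 0.

Let pDl z : {morph p^~ z : x y / x + y}.
Proof. by move=> x y; rewrite !(pC _ z) pDr. Qed.

Local Notation N := (#|Z|%:R).
Let N0 : 0 < N :> R. Proof. exact: card_gt0_Z. Qed.

Variable f : Z -> R[i].
Hypothesis f1 : forall x, sqm (f x) <= 1.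

(** The symmetry argument: the mass of [spec] on [K] becomes an average over [x] of the sums bounded
    by [card_radical_ge]. *)
Lemma radical_spec_ge (K : {set Z * Z}) : subgroup K ->
  (\sum_(k in K) spec p f k) ^+ 4 <=
  #|K|%:R ^+ 3 * #|radical K (fun k l => p k.2 l.1)|%:R.
Proof.
move=> sK; set Rd := radical _ _; set s := \sum_(k in K) _.
have K0 : 0 < #|K|%:R :> R by rewrite ltr0n subgroup_card_gt0.
pose b x k : R[i] := (amb p f k)^*%C * e (- p k.2 x) * (N^-1)%:C.
pose S x := \sum_(k in K) \sum_(l in K)
  b x k * f (x + (k + l).1) * (f (x + l.1))^*%C * e (- p k.2 l.1).
have b1 x k : sqm (b x k) <= 1.
  rewrite !sqmM sqmJ sqm_e mulr1 sqm_real exprVn.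
  by have /andP[_] := spec01 p f1 k.
(* Write [sqm (amb k)] as [amb k] times its conjugate and, for each [l] in [K], shift the variable
   of [amb k] by [l.1]; this creates the phase [p k.2 l.1]. *)
have ES : (#|K|%:R * (N * s))%:C = \sum_x S x.
  rewrite !rmorphM /= real_complex_sum exchange_big !mulr_sumr.
  apply: eq_bigr => k kK; rewrite exchange_big.
  rewrite rmorph_nat mulr_natl -sumr_const; apply: eq_bigr => l lK.
  have -> : N%:C * (spec p f k)%:C = (N^-1)%:C * (amb p f k * (amb p f k)^*%C) :> R[i].
    rewrite -sqm_conj -!rmorphM; congr (_%:C); rewrite /spec.
    by field; rewrite lt0r_neq0.
  rewrite {1}/amb /hat (reindex_inj (addIr l.1)) /= mulr_suml mulr_sumr.
  apply: eq_bigr => x _; rewrite /b /mder pDr opprD eD.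
  by rewrite -[x + l.1 + k.1]addrA [l.1 + k.1]addrC; ring.
have SR x : sqm (S x) ^+ 2 <= #|K|%:R ^+ 7 * #|Rd|%:R.
  apply: (@card_radical_ge _ _ K sK (fun k l => p k.2 l.1) _ _ (b x)
    (fun k => f (x + k.1)) (fun l => (f (x + l.1))^*%C)) => //.
  - by move=> l k k' /=; rewrite -pDl.
  - by move=> k l l' /=; rewrite -pDr.
  - by move=> l; rewrite sqmJ.
have le1 : (#|K|%:R * (N * s)) ^+ 2 <= N * \sum_x sqm (S x).
  by rewrite -sqm_real ES; exact: sqm_sum_le_card.
have le2 : (\sum_x sqm (S x)) ^+ 2 <= N ^+ 2 * (#|K|%:R ^+ 7 * #|Rd|%:R).
  apply: le_trans (sqr_sum_le _ _) _.
  rewrite expr2 -mulrA ler_wpM2l // mulr_natl -sumr_const.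
  by apply: ler_sum => x _; exact: SR.
have le3 : ((#|K|%:R * (N * s)) ^+ 2) ^+ 2 <=
    N ^+ 2 * (N ^+ 2 * (#|K|%:R ^+ 7 * #|Rd|%:R)).
  apply: le_trans (ler_wpM2l _ le2); last by rewrite exprn_ge0.
  rewrite -exprMn ler_sqr ?nnegrE ?sqr_ge0 // mulr_ge0 // sumr_ge0 // => x _.
  exact: sqm_ge0.
rewrite -(ler_pM2l (mulr_gt0 (exprn_gt0 4 K0) (exprn_gt0 4 N0))).
by move: le3; lra.
Qed.

(* If [k] is in [K] then [e (- p k.2 x)] is, on each fibre of [rho], the
   derivative of [e (- Q)] in the direction [k.1] up to a constant phase; so
   [spec] on [K] is controlled by the [U^2] norms of the pieces of
   [f e (- Q)] on these fibres. *)
Lemma sum_spec_sqr_le (K : {set Z * Z}) (rho : Z -> Z) (Q : Z -> circle R)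
    (t : R) :
  {morph rho : x y / x + y} ->
  (forall k x, k \in K -> rho k.1 = 0 /\
    p k.2 x = Q (x + k.1) - Q x - Q k.1 + p k.2 (rho x)) ->
  (forall v eta, v \in rho @: [set: Z] ->
    sqm (hat p (fun x => f x * e (- Q x) * (rho x == v)%:R) eta) <= t) ->
  \sum_(k in K) spec p f k ^+ 2 <= #|rho @: [set: Z]|%:R ^+ 2 * t / N.
Proof.
move=> rhoD KP hat_le; set I := rho @: _.
pose g x : R[i] := f x * e (- Q x); pose G v x : R[i] := g x * (rho x == v)%:R.
have t0 : 0 <= t.
  by apply: le_trans (hat_le (rho 0) 0 _); rewrite ?sqm_ge0 ?imset_f.
have G1 v x : sqm (G v x) <= 1.
  rewrite !sqmM sqm_e mulr1 sqm_nat; case: (_ == _) => /=.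
    by rewrite expr1n mulr1.
  by rewrite expr0n mulr0.
(* The fourth moment of the Fourier transform is at most its largest squared value times the second
   moment. *)
have acorr_le v : v \in I -> \sum_h sqm (acorr (G v) h) <= t * N.
  move=> vI; rewrite -(ler_pM2l N0) (sum_sqm_acorr pC pDr p_nondeg).
  apply: le_trans (_ : t * \sum_xi sqm (hat p (G v) xi) <= _).
    rewrite mulr_sumr; apply: ler_sum => xi _; rewrite expr2.
    by rewrite ler_wpM2r ?sqm_ge0 // hat_le.
  rewrite (parseval pC pDr p_nondeg) mulrCA ler_wpM2l //.
  by rewrite ler_wpM2l // sum_le_card.
pose T h := #|I|%:R * \sum_(v in I) sqm (acorr (G v) h).
have T0 h : 0 <= T h by rewrite mulr_ge0 // sumr_ge0 // => v _; exact: sqm_ge0.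
have amb_le k : k \in K -> sqm (amb p f k) <= T k.1.
  move=> kK; have -> : amb p f k =
      e (Q k.1) * \sum_(v in I) e (- p k.2 v) * acorr (G v) k.1.
    rewrite /amb /hat (partition_big rho (mem I)) /=; last first.
      by move=> x _; rewrite imset_f.
    rewrite mulr_sumr; apply: eq_bigr => v vI.
    rewrite /acorr !mulr_sumr big_mkcond; apply: eq_bigr => x _.
    have [rk kx] := KP k x kK; rewrite /G rhoD rk addr0.
    case: eqP => [xv|_]; last by rewrite !mulr0 mul0r !mulr0.
    rewrite !mulr1 kx xv /g /mder rmorphM /= -eN.
    rewrite !opprD !opprK !eD; ring.
  rewrite sqmM sqm_e mul1r; apply: sqm_sum_le => v _.
  by rewrite sqm_e.
(* Only one factor is bounded by [T]: the other is kept because it sums to at most 1 over each fibre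
   [h]. *)
have spec_le k : k \in K -> spec p f k ^+ 2 <= spec p f k * (T k.1 / N ^+ 2).
  move=> kK; have /andP[s0 _] := spec01 p f1 k.
  rewrite expr2 ler_wpM2l // /spec ler_wpM2r ?invr_ge0 ?exprn_ge0 //.
  exact: amb_le.
apply: le_trans (ler_sum _ spec_le) _.
apply: le_trans (_ : \sum_q spec p f q * (T q.1 / N ^+ 2) <= _).
  rewrite [leRHS](bigID (mem K)) /= ler_wpDr // sumr_ge0 // => q _.
  have /andP[s0 _] := spec01 p f1 q.
  by rewrite mulr_ge0 // divr_ge0 ?exprn_ge0.
rewrite sum_pairs; apply: le_trans (_ : \sum_h T h / N ^+ 2 <= _).
  apply: ler_sum => h _; rewrite /= -mulr_suml ler_piMl //.
    by rewrite divr_ge0 ?exprn_ge0.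
  exact: sum_spec_fiber.
rewrite -mulr_suml ler_pdivrMr ?exprn_gt0 // -mulr_sumr exchange_big /=.
have -> : #|I|%:R ^+ 2 * t / N * N ^+ 2 = #|I|%:R * (#|I|%:R * (t * N)) :> R.
  by field; rewrite lt0r_neq0.
rewrite ler_wpM2l // mulr_natl -sumr_const; apply: ler_sum => v; exact: acorr_le.
Qed.

(* Expand the indicator function of [rho x = v] into characters of [rho x]. *)
Lemma remove_indicator (rho : Z -> Z) (Q : Z -> circle R) v eta :
  exists zeta, sqm (hat p (fun x => f x * e (- Q x) * (rho x == v)%:R) eta) <=
    sqm (\sum_x f x * e (- (Q x + p eta x - p zeta (rho x)))).
Proof.
set h := hat _ _ _; pose S zeta := \sum_x f x * e (- (Q x + p eta x - p zeta (rho x))).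
have E : N * h = \sum_zeta e (- p zeta v) * S zeta.
  rewrite /h /hat mulr_sumr.
  under [RHS]eq_bigr do rewrite mulr_sumr.
  rewrite exchange_big; apply: eq_bigr => x _.
  have -> : N * (f x * e (- Q x) * (rho x == v)%:R * e (- p eta x)) =
     f x * e (- Q x) * e (- p eta x) * (N *+ (rho x - v == 0)).
    by rewrite subr_eq0 -[N *+ _]mulr_natr; ring.
  rewrite -(orthogonality pC pDr p_nondeg) mulr_sumr; apply: eq_bigr => zeta _.
  by rewrite (morphDB (pDr _)) !opprD opprK !eD; ring.
have [zeta _ le] : exists2 zeta, zeta \in [set: Z] & sqm h <= sqm (S zeta).
  apply: exists_sum_le; first by apply/set0Pn; exists 0; rewrite inE.
  rewrite sumr_const cardsT -[_ *+ #|_|]mulr_natl.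
  rewrite [leRHS](eq_bigl xpredT) => [|zeta]; last by rewrite inE.
  rewrite -(ler_pM2l N0) mulrA -expr2 -sqm_nat -sqmM E.
  by apply: sqm_sum_le => zeta _; rewrite sqm_e.
by exists zeta.
Qed.

End Correlation.

Lemma correlation_of_isotropic (R : realType) (m : nat) (c C : R) :
  (0 < m)%N -> 0 < c -> 0 < C -> exists2 ep : R, 0 < ep &
  forall (Z : finZmodType) n (b : 'I_n -> Z) d a (f : Z -> R[i]) (K : {set Z * Z}),
    basis b d a -> torsion m Z -> (forall x, sqm (f x) <= 1) -> subgroup K ->
    (forall k l, k \in K -> l \in K ->
       pairing R d a k.2 l.1 = pairing R d a l.2 k.1) ->
    #|K|%:R <= C * #|Z|%:R -> c * #|Z|%:R <= \sum_(k in K) spec (pairing R d a) f k ->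
    exists2 P : Z -> circle R, poly_deg_le 2 P &
      ep ^+ 2 * #|Z|%:R ^+ 2 < sqm (\sum_x f x * e (- P x)).
Proof.
(* [k0] bounds the index of [H], [r] the image of [rho], and [c3 * N] the mass on [K2] from below.
   The factor [1 + C] in [ep] makes the final contradiction strict, as [C < (1 + C) ^+ 2]. *)
move=> m0 c0 C0; pose k0 := (Num.truncn c^-1).+1.
pose r : R := (m ^ (m.+1 * k0))%:R.
have r0 : 0 < r by rewrite ltr0n expn_gt0 m0.
pose c3 := c ^+ 2 / (r * C).
have c30 : 0 < c3 by rewrite divr_gt0 ?exprn_gt0 // mulr_gt0.
pose ep := c3 / (r * (1 + C)).
have C1 : 0 < 1 + C by rewrite addr_gt0.
have ep0 : 0 < ep by rewrite divr_gt0 // mulr_gt0.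
exists ep => // Z n b d a f K bP tZ f1 sK iso cardK massK.
set p := pairing R d a in iso massK.
have pC : forall x y, p x y = p y x := pairingC R d a.
have pDr : forall x, {morph p x : y z / y + z} := pairingDr R bP.
have pnd : forall x, (forall y, p x y = 0) -> x = 0.
  by move=> x; apply: (pairing_nondegenerate bP).
set N := #|Z|%:R in cardK massK *.
have N0 : 0 < N := card_gt0_Z R Z.
have spec0 k : 0 <= spec p f k by have /andP[] := spec01 p f1 k.
pose H := [set k.1 | k in K].
have sH : subgroup H.
  split; first by apply/imsetP; exists 0; rewrite ?subgroup0.
  move=> _ _ /imsetP[k kK ->] /imsetP[l lK ->].
  by apply/imsetP; exists (k - l); rewrite ?subgroupB.
(* Each fibre over [H] carries mass at most 1. *)
have H_ge : c * N <= #|H|%:R.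
  apply: le_trans massK _.
  apply: le_trans (_ : \sum_(h in H) \sum_xi spec p f (h, xi) <= _); last first.
    rewrite -sumr_const; apply: ler_sum => h _.
    exact: (sum_spec_fiber pC pDr pnd f1).
  rewrite pair_big_dep /= big_mkcond [leRHS]big_mkcond /=.
  apply: ler_sum => -[h xi] _ /=; case: ifP => hK; last by case: ifP.
  by rewrite (imset_f _ hK).
have indexH : (#|Z| <= k0 * #|H|)%N.
  rewrite -(ler_nat R) natrM -/N; apply: le_trans (_ : c^-1 * #|H|%:R <= _).
    by rewrite mulrC ler_pdivlMr // mulrC.
  by rewrite ler_wpM2r // ltW // truncnS_gt.
have [rho [rhoD rhoH card_rho]] := bounded_retraction bP m0 tZ sH indexH.
pose sig x := x - rho x.
have sigD : {morph sig : x y / x + y}.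
  by move=> x y; rewrite /sig rhoD opprD addrACA.
(* [s] is an arbitrary section of [K] over [H]. Then [B] is additive in its second argument, and
   isotropy makes it symmetric. *)
have [s sP] : exists s : Z -> Z, forall h, h \in H -> (h, s h) \in K.
  apply: (fin_all_exists (P := fun h s => h \in H -> (h, s) \in K)) => h.
  have [/imsetP[[h' xi] kK ->]|_] := boolP (h \in H); first by exists xi.
  by exists 0.
have sigK x : (sig x, s (sig x)) \in K by exact: sP (rhoH x).
pose B x y := p (s (sig x)) (sig y).
have BC x y : B x y = B y x by exact: (iso _ _ (sigK x) (sigK y)).
have BDr x : {morph B x : y z / y + z} by move=> y z; rewrite /B sigD pDr.
have [Q QD] := symmetric_form_integrable bP BDr BC.
pose K2 := [set k in K | rho k.1 == 0].
have sK2 : subgroup K2.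
  split; first by rewrite inE subgroup0 //= (morphD0 rhoD).
  move=> k l; rewrite !inE => /andP[kK /eqP k0'] /andP[lK /eqP l0].
  by rewrite subgroupB //= (morphDB rhoD) k0' l0 subrr.
have K2K : K2 \subset K by apply/subsetP => k; rewrite inE => /andP[].
have K2P k x : k \in K2 -> rho k.1 = 0 /\
    p k.2 x = Q (x + k.1) - Q x - Q k.1 + p k.2 (rho x).
  rewrite inE => /andP[kK /eqP rk]; split=> //.
  have sk : sig k.1 = k.1 by rewrite /sig rk subr0.
  have -> : Q (x + k.1) - Q x - Q k.1 = B x k.1.
    by rewrite QD -addrA -opprD [_ + B x k.1]addrC addrK.
  (* Isotropy turns [B x k.1] into [p k.2 (x - rho x)]. *)
  rewrite /B sk (iso _ _ (sigK x) kK) /= -pDr subrK //.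
have cardK2 : #|K|%:R <= r * #|K2|%:R.
  have phiD : {morph (fun k : Z * Z => rho k.1) : k l / k + l}.
    by move=> k l /=; rewrite rhoD.
  rewrite /r -natrM ler_nat.
  apply: leq_trans (card_le_image_kernel phiD sK) _; rewrite leq_mul2r.
  apply/orP; right; apply: leq_trans card_rho; apply: subset_leq_card.
  by apply/subsetP => _ /imsetP[k _ ->]; rewrite imset_f.
have K0 : 0 < #|K|%:R :> R by rewrite ltr0n subgroup_card_gt0.
have mass2 : c3 * N <= \sum_(k in K2) spec p f k.
  have := subgroup_mass_le (spec01 p f1) (spec_pd pC pDr f1) sK sK2 K2K.
  set s1 := \sum_(k in K) _ in massK *; set s2 := \sum_(k in K2) _ => le1.
  have s20 : 0 <= s2 by exact: sumr_ge0.
  have le2 : #|K|%:R * s1 ^+ 2 <= r * (#|K|%:R ^+ 2 * s2).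
    apply: le_trans (ler_wpM2r (sqr_ge0 _) cardK2) _.
    by rewrite -mulrA ler_wpM2l // ltW.
  have le3 : s1 ^+ 2 <= r * #|K|%:R * s2.
    by rewrite -(ler_pM2l K0); move: le2; lra.
  have le4 : (c * N) ^+ 2 <= s1 ^+ 2.
    by rewrite ler_sqr ?nnegrE ?sumr_ge0 // mulr_ge0 // ltW.
  have le5 : r * #|K|%:R * s2 <= r * (C * N) * s2.
    by rewrite ler_wpM2r // ler_wpM2l // ltW.
  rewrite mulrAC ler_pdivrMr; last by rewrite mulr_gt0.
  by rewrite -(ler_pM2r N0); move: (le_trans le4 (le_trans le3 le5)); lra.
have mass3 : c3 ^+ 2 * N <= C * \sum_(k in K2) spec p f k ^+ 2.
  have le1 : (c3 * N) ^+ 2 <= (\sum_(k in K2) spec p f k) ^+ 2.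
    by rewrite ler_sqr ?nnegrE ?sumr_ge0 // mulr_ge0 // ltW.
  have le2 : (\sum_(k in K2) spec p f k) ^+ 2 <=
      C * N * \sum_(k in K2) spec p f k ^+ 2.
    apply: le_trans (sqr_sum_le _ _) _; apply: ler_wpM2r.
      by apply: sumr_ge0 => k _; rewrite sqr_ge0.
    by apply: le_trans cardK; rewrite ler_nat subset_leq_card.
  by rewrite -(ler_pM2r N0); move: (le_trans le1 le2); lra.
pose t := ep ^+ 2 * N ^+ 2.
pose g v eta := hat p (fun x => f x * e (- Q x) * (rho x == v)%:R) eta.
(* If all these Fourier coefficients were small, [sum_spec_sqr_le] would contradict [mass3]. *)
have [/forallP small|] := boolP [forall v, forall eta, sqm (g v eta) <= t].
  exfalso; have := @sum_spec_sqr_le R Z p pC pDr pnd f f1 K2 rho Q t rhoD.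
  move=> /(_ (fun k x => K2P k x)) le1.
  have {}le1 := le1 (fun v eta _ => forallP (small v) eta).
  have le2 : #|rho @: [set: Z]|%:R ^+ 2 * t / N <= r ^+ 2 * ep ^+ 2 * N.
    rewrite ler_pdivrMr // (_ : r ^+ 2 * _ * N * N = r ^+ 2 * t); last first.
      by rewrite /t; ring.
    apply: ler_wpM2r; first by rewrite /t mulr_ge0 ?sqr_ge0.
    by rewrite ler_sqr ?nnegrE ?ler_nat.
  have le3 := le_trans mass3 (ler_wpM2l (ltW C0) (le_trans le1 le2)).
  have : c3 ^+ 2 <= C * (r ^+ 2 * ep ^+ 2).
    by rewrite -(ler_pM2r N0); move: le3; lra.
  have -> : r ^+ 2 * ep ^+ 2 = c3 ^+ 2 / (1 + C) ^+ 2.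
    by rewrite /ep; field; rewrite !lt0r_neq0.
  rewrite mulrCA ler_pMr ?exprn_gt0 // ler_pdivlMr ?exprn_gt0 // mul1r.
  by have := exprn_gt0 2 C0; lra.
rewrite negb_forall => /existsP[v]; rewrite negb_forall => /existsP[eta].
rewrite -ltNge => t_lt.
have [zeta zetaP] := remove_indicator pC pDr pnd f rho Q v eta.
(* The terms added to [Q] are additive in [x], so [B] remains the polarisation. *)
exists (fun x => Q x + p eta x - p zeta (rho x)); last exact: lt_le_trans zetaP.
apply: (quadratic_poly_deg_le (B := B)) => // x y.
rewrite QD rhoD !pDr opprD [X in _ = X + _]addrACA.
rewrite [X in _ = X + _ + _]addrACA; set E := p eta x + _; set W := - _ - _.
by rewrite -[LHS]addrA -[LHS]addrA [B x y + _]addrC !addrA.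
Qed.

Theorem theorem1p9 (R : realType) (m : nat) (delta : R) (m_gt0 : (0 < m)%N)
    (delta_gt0 : 0 < delta) :
  exists2 eps : R, 0 < eps &
    forall (Z : finZmodType) (f : Z -> R[i]),
      torsion m Z -> one_bounded f -> delta%:C < U3_norm f ->
      exists2 P : Z -> circle R, poly_deg_le 2 P &
        eps%:C < `|\E_x (f x * e (- P x))|.
Proof.
have [c0 [C [c0_gt0 C_gt0 structured]]] :=
  structured_subgroup m_gt0 (exprn_gt0 8 delta_gt0).
(* [c1 * N] bounds the size of the radical from below through [radical_spec_ge], and [c2 * N] its
   mass through [subgroup_mass_le]. *)
pose c1 := c0 ^+ 4 / C ^+ 3.
have c1_gt0 : 0 < c1 by rewrite divr_gt0 // exprn_gt0.
pose c2 := c1 * c0 ^+ 2 / C ^+ 2.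
have c2_gt0 : 0 < c2 by rewrite divr_gt0 ?exprn_gt0 // mulr_gt0 // exprn_gt0.
have [eps eps_gt0 epsP] := correlation_of_isotropic m_gt0 c2_gt0 C_gt0.
exists eps => // Z f tZ f_le1 normf.
have f1 x : sqm (f x) <= 1 by rewrite sqm_le1.
have [n [b [d [a bP]]]] := basis_exists Z.
pose p := pairing R d a.
have pC : forall x y, p x y = p y x := pairingC R d a.
have pDr : forall x, {morph p x : y z / y + z} := pairingDr R bP.
have pnd : forall x, (forall y, p x y = 0) -> x = 0.
  by move=> x; apply: (pairing_nondegenerate bP).
pose N : R := #|Z|%:R; have N0 : 0 < N := card_gt0_Z R Z.
have tG : torsion m (Z * Z)%type.
  move=> [x y]; have -> : (x, y) *+ m = (x *+ m, y *+ m).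
    by elim: (m) => // j IH; rewrite !mulrS IH.
  by rewrite !tZ.
(* The eighth power of the U^3 norm of [f]. *)
pose u := (\sum_q spec p f q ^+ 2) / N.
have u_gt : delta ^+ 8 < u.
  have U3E : U3_avg f = u%:C by exact: U3_avg_spec.
  have u0 : 0 <= u%:C.
    rewrite ler0c divr_ge0 ?(ltW N0) // sumr_ge0 // => q _; exact: sqr_ge0.
  move: normf; rewrite /U3_norm U3E -(ltr_pXn2r (n := 8)) //.
  - by rewrite rootCK // -rmorphXn ltcR.
  - by rewrite nnegrE ler0c ltW.
  - by rewrite nnegrE rootC_ge0.
have spec2 : delta ^+ 8 * N <= \sum_q spec p f q ^+ 2.
  by rewrite -ler_pdivlMr // ltW.
have [K [sK cardK massK]] := structured _ N (spec p f) tG N0 (spec01 p f1)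
  (spec_pd pC pDr f1) (sum_spec pC pDr pnd f1) spec2.
pose form (k l : Z * Z) := p k.2 l.1.
have formDl l : {morph form^~ l : k k' / k + k'}.
  by move=> k k' /=; rewrite /form /= [LHS]pC pDr !(pC l.1).
have formDr k : {morph form k : l l' / l + l'} by move=> l l'; exact: pDr.
pose Rd := radical K form; have sRd : subgroup Rd by exact: subgroup_radical.
have RdK : Rd \subset K by apply/subsetP => k; rewrite inE => /andP[].
have iso k l : k \in Rd -> l \in Rd -> p k.2 l.1 = p l.2 k.1.
  move=> kR /(subsetP RdK) lK; move: kR; rewrite inE => /andP[_ /forall_inP].
  by move=> /(_ l lK)/eqP.
have K0 : 0 < #|K|%:R :> R by rewrite ltr0n subgroup_card_gt0.
have cardRd : #|Rd|%:R <= C * N.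
  by apply: le_trans cardK; rewrite ler_nat subset_leq_card.
have spec0 q : 0 <= spec p f q by have /andP[] := spec01 p f1 q.
have massRd : c2 * N <= \sum_(k in Rd) spec p f k.
  have := radical_spec_ge pC pDr f1 sK; rewrite -/form -/Rd.
  have := subgroup_mass_le (spec01 p f1) (spec_pd pC pDr f1) sK sRd RdK.
  set s := \sum_(k in K) _ in massK *; set s1 := \sum_(k in Rd) _ => le1 le2.
  have s10 : 0 <= s1 by exact: sumr_ge0.
  have c0N : 0 <= c0 * N by rewrite mulr_ge0 // ltW.
  have s0 : 0 <= s by exact: le_trans massK.
  have Rd_ge : c1 * N <= #|Rd|%:R.
    have le3 : (c0 * N) ^+ 4 <= s ^+ 4 by rewrite lerXn2r ?nnegrE.
    have le4 : #|K|%:R ^+ 3 * #|Rd|%:R <= (C * N) ^+ 3 * #|Rd|%:R.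
      by rewrite ler_wpM2r // lerXn2r ?nnegrE // mulr_ge0 // ltW.
    rewrite mulrAC ler_pdivrMr ?exprn_gt0 //.
    rewrite -(ler_pM2r (exprn_gt0 3 N0)).
    by move: (le_trans le3 (le_trans le2 le4)); lra.
  have le3 : c1 * N * (c0 * N) ^+ 2 <= #|Rd|%:R * s ^+ 2.
    have c1N : 0 <= c1 * N by exact: ltW (mulr_gt0 c1_gt0 N0).
    by apply: ler_pM => //; rewrite ?sqr_ge0 // ler_sqr ?nnegrE.
  have le4 : #|K|%:R ^+ 2 * s1 <= (C * N) ^+ 2 * s1.
    by rewrite ler_wpM2r // lerXn2r ?nnegrE // mulr_ge0 // ltW.
  rewrite mulrAC ler_pdivrMr ?exprn_gt0 //.
  rewrite -(ler_pM2r (exprn_gt0 2 N0)).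
  by move: (le_trans le3 (le_trans le1 le4)); lra.
have [P Pquad Pcorr] := epsP Z n b d a f Rd bP tZ f1 sRd iso cardRd massRd.
exists P => //; rewrite -(ltr_pXn2r (n := 2)) // ?nnegrE ?ler0c ?(ltW eps_gt0) //.
rewrite -sqm_norm -rmorphXn ltcR /avg sqmM.
have -> : sqm (#|Z|%:R^-1 : R[i]) = N ^- 2.
  rewrite -[X in sqm X](_ : (N^-1)%:C = _) ?sqm_real ?exprVn //.
  by rewrite fmorphV /= rmorph_nat.
by rewrite mulrC ltr_pdivlMr ?exprn_gt0.
Qed.
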